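(* Let $f\in S_\alpha$, where $|\alpha|<\pi/2$. Then $$|P_f(z)|\ge\frac{2-|1-e^{2i\alpha}|\,|z|}{|1+e^{2i\alpha}|}\qquad\text{for all } z\in\mathbb{D}.$$ The inequality is sharp.
   Context: $\mathbb{D}=\{z\in\mathbb{C}:|z|<1\}$. For real $\alpha$ with $|\alpha|<\pi/2$, the Robertson class $S_\alpha$ consists of the locally univalent analytic functions $f$ in $\mathbb{D}$ (that is, $f'\ne0$ in $\mathbb{D}$) with $f(0)=0$, $f'(0)=1$ and $\operatorname{Re}\left\{e^{i\alpha}\left(1+z\frac{f''(z)}{f'(z)}\right)\right\}>0$ for all $z\in\mathbb{D}$. The pole function (the pole of the best Möbius approximation of $f$ at $z$) is $P_f(z)=z+2\,f'(z)/f''(z)\in\mathbb{C}\cup\{\infty\}$, with $P_f(z)=\infty$ when $f''(z)=0$, and $|\infty|=+\infty$. *)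

(* Defs.v *)
From Stdlib Require Import Reals.
From Coquelicot Require Import Coquelicot.

Open Scope R_scope.

Definition in_disk (z : C) : Prop := Cmod z < 1.

(* e^{it} for real t. *)
Definition Cexpi (t : R) : C := (cos t, sin t).

(* Analytic in the sense of Weierstrass: around every point of the disk, f is
   the sum of a convergent power series with complex coefficients. *)
Definition analytic_in_disk (f : C -> C) : Prop :=
  forall z0 : C, in_disk z0 ->
  exists (a : nat -> C) (r : R), 0 < r /\
    forall z : C, Cmod (z - z0) < r ->
      is_pseries (K := C_AbsRing) (V := C_NormedModule) a (z - z0)%C (f z).

(* [C_derive] is a total operator; it is the complex derivative wherever that
   exists, in particular at points of the disk for f analytic there. Values of
   f outside the disk are irrelevant. *)
Definition Robertson (alpha : R) (f : C -> C) : Prop :=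
  analytic_in_disk f /\
  (forall z : C, in_disk z -> C_derive f z <> RtoC 0) /\
  f (RtoC 0) = RtoC 0 /\
  C_derive f (RtoC 0) = RtoC 1 /\
  (forall z : C, in_disk z ->
     0 < Re (Cexpi alpha *
             (1 + z * (C_derive (C_derive f) z / C_derive f z)))%C).

(* The extended plane: [None] is the point at infinity. *)
Definition Cinf : Type := option C.

Definition Cinf_mod (w : Cinf) : Rbar :=
  match w with
  | Some w => Finite (Cmod w)
  | None => p_infty
  end.

Definition pole (f : C -> C) (z : C) : Cinf :=
  if Ceq_dec (C_derive (C_derive f) z) (RtoC 0) then None
  else Some (z + 2 * (C_derive f z / C_derive (C_derive f) z))%C.

Definition pole_bound (alpha : R) (z : C) : R :=
  (2 - Cmod (1 - Cexpi (2 * alpha)) * Cmod z) / Cmod (1 + Cexpi (2 * alpha)).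

(* Main.v *)
Require Import Defs.
From Stdlib Require Import Reals Lra Lia ClassicalEpsilon List.
From Coquelicot Require Import Coquelicot.
Open Scope R_scope.

(** Put A = 1 + e^(-2 i alpha) and p = e^(i alpha) (1 + z f''/f'). Since
    Re p > 0 and p(0) = e^(i alpha), the function
    (p - e^(i alpha)) / (p + e^(-i alpha)) maps the disk into itself and vanishes
    at 0, so by the Schwarz lemma it is z phi(z) with |phi| <= 1. Solving for f''/f'
    gives phi = f'' / (A f' + z f'') and, for the pole P = z + 2 f'/f'',
      A P = 2/phi - z (1 - e^(-2 i alpha)).
    The bound follows from the triangle inequality, as
    |A| = |1 + e^(2 i alpha)| and |1 - e^(-2 i alpha)| = |1 - e^(2 i alpha)|
    ([pole_bound_le]).

    Equality at a given z holds when phi is a unimodular constant c such that 2/c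
    points in the direction of z (1 - e^(-2 i alpha)). This phi belongs to the
    function with derivative (1 - c z)^(-A) ([extremal], [extremal_pole]).

    The Schwarz lemma is obtained without Cauchy's theory. An analytic function
    has a second order jet at each point, the mean over four points z + t i^k
    kills the linear and quadratic terms, and so |phi|^2 + eps |z|^2 has no local
    maximum ([subharmonic_no_local_max]); compactness of closed disks does the
    rest ([maximum_modulus], [schwarz]). The jets of f' and f'' come from termwise
    differentiation of power series ([psum_cderiv]).

    For the extremal functions, (1 - w)^(-B) is defined by its binomial series,
    which solves (1 - w) g' = B g. This equation shows that certain products of
    such functions have zero derivative, hence that the function has no zero and
    that it has a power series around every point of the disk ([binpow_opp],
    [binpow_recenter]). *)


(** * Series of complex numbers *)

Definition Cseries (a : nat -> C) (l : C) : Prop :=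
  is_series (K := C_AbsRing) (V := C_NormedModule) a l.

Lemma Cseries_ext (a b : nat -> C) (l : C) :
  (forall n, a n = b n) -> Cseries a l -> Cseries b l.
Proof. apply is_series_ext. Qed.

Lemma Cseries_plus (a b : nat -> C) (la lb : C) :
  Cseries a la -> Cseries b lb -> Cseries (fun n => a n + b n)%C (la + lb)%C.
Proof. apply (is_series_plus (K := C_AbsRing) (V := C_NormedModule)). Qed.

Lemma Cseries_scal (c : C) (a : nat -> C) (l : C) :
  Cseries a l -> Cseries (fun n => c * a n)%C (c * l)%C.
Proof. apply (is_series_scal (K := C_AbsRing) (V := C_NormedModule)). Qed.

Lemma Cseries_minus (a b : nat -> C) (la lb : C) :
  Cseries a la -> Cseries b lb -> Cseries (fun n => a n - b n)%C (la - lb)%C.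
Proof. apply (is_series_minus (K := C_AbsRing) (V := C_NormedModule)). Qed.

Lemma Cseries_cons (a : nat -> C) (l : C) :
  Cseries (fun n => a (S n)) l -> Cseries a (a O + l)%C.
Proof.
  intros H. apply (is_series_decr_1 (K := C_AbsRing) (V := C_NormedModule)).
  eapply eq_ind; [exact H|].
  change (l = (a O + l) + - a O)%C. ring.
Qed.

Lemma Cseries_unique (a : nat -> C) (l l' : C) :
  Cseries a l -> Cseries a l' -> l = l'.
Proof.
  intros H H'.
  exact (filterlim_locally_unique (K := C_AbsRing) (V := C_NormedModule) _ l l' H H').
Qed.

Lemma Cseries_zero : Cseries (fun _ => RtoC 0) 0.
Proof.
  apply (filterlim_ext (fun _ => RtoC 0)).
  - intros n. induction n as [|n IH].
    + now rewrite sum_O.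
    + rewrite sum_Sn, <- IH. symmetry. exact (Cplus_0_l 0).
  - apply filterlim_const.
Qed.

Lemma Cseries_le (a : nat -> C) (b : nat -> R) (l : C) (m : R) :
  (forall n, Cmod (a n) <= b n) -> Cseries a l -> is_series b m -> Cmod l <= m.
Proof.
  intros Hab Ha Hb.
  assert (Hn : is_lim_seq
                 (fun n => Cmod (sum_n (G := C_AbelianMonoid) a n)) (Cmod l)).
  { apply (filterlim_comp _ _ _ _ _ _ _ _ Ha
             (filterlim_norm (K := C_AbsRing) (V := C_NormedModule) l)). }
  refine (is_lim_seq_le _ (sum_n b) (Cmod l) m _ Hn Hb).
  intros n. induction n as [|n IH].
  - rewrite !sum_O. apply Hab.
  - rewrite !sum_Sn. eapply Rle_trans; [apply Cmod_triangle|].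
    apply Rplus_le_compat; [exact IH | apply Hab].
Qed.

Lemma Cseries_dominated (a : nat -> C) (b : nat -> R) :
  (forall n, Cmod (a n) <= b n) -> ex_series b -> exists l, Cseries a l.
Proof.
  intros Hab Hb.
  exact (ex_series_le (K := C_AbsRing) (V := C_CompleteNormedModule) a b Hab Hb).
Qed.

(** * Power series and their derivatives *)

Definition summable_within (a : nat -> C) (r : R) : Prop :=
  forall rho, 0 <= rho < r -> ex_series (fun n => Cmod (a n) * rho ^ n).

(** The sum is chosen among the limits, which makes it a total function; the
    value outside the disk of convergence is arbitrary. *)
Definition psum (a : nat -> C) (w : C) : C :=
  epsilon (inhabits (RtoC 0)) (Cseries (fun n => a n * w ^ n)%C).

Lemma psum_unique (a : nat -> C) (w l : C) :
  Cseries (fun n => a n * w ^ n)%C l -> psum a w = l.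
Proof.
  intros H. apply (Cseries_unique (fun n => a n * w ^ n)%C); [|exact H].
  unfold psum. apply epsilon_spec. now exists l.
Qed.

Lemma psum_correct (a : nat -> C) (r : R) (w : C) :
  summable_within a r -> Cmod w < r ->
  Cseries (fun n => a n * w ^ n)%C (psum a w).
Proof.
  intros Ha Hw. unfold psum. apply epsilon_spec.
  apply (Cseries_dominated _ (fun n => Cmod (a n) * Cmod w ^ n)).
  - intros n. rewrite Cmod_mult, Cmod_pow. lra.
  - apply Ha. split; [apply Cmod_ge_0 | exact Hw].
Qed.

Lemma is_pseries_Cseries (a : nat -> C) (w l : C) :
  is_pseries (K := C_AbsRing) (V := C_NormedModule) a w l <->
  Cseries (fun n => a n * w ^ n)%C l.
Proof.
  assert (E : forall n, (a n * w ^ n)%C =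
    scal (K := C_AbsRing) (V := C_NormedModule) (pow_n (K := C_AbsRing) w n) (a n)).
  { intros n. change (a n * w ^ n = pow_n (K := C_AbsRing) w n * a n)%C.
    now rewrite Cmult_comm. }
  split; intros H; (eapply is_series_ext; [|exact H]); intros n; cbv beta;
    [symmetry|]; apply E.
Qed.

Lemma Rabs_Cmod_pow (a : nat -> C) (rho : R) (n : nat) :
  0 <= rho -> Rabs (Cmod (a n) * rho ^ n) = Cmod (a n) * rho ^ n.
Proof.
  intros H. apply Rabs_pos_eq, Rmult_le_pos; [apply Cmod_ge_0 | now apply pow_le].
Qed.

(** Absolute summability is traded for the real radius of convergence, which
    shifts and termwise differentiation are known to preserve. *)
Lemma summable_within_CV_radius (a : nat -> C) (r : R) :
  (forall rho, 0 <= rho < r -> Rbar_le rho (CV_radius (fun n => Cmod (a n)))) ->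
  summable_within a r.
Proof.
  intros H rho Hrho.
  apply (ex_series_ext (fun n => Rabs (Cmod (a n) * rho ^ n))).
  - intros n. now apply Rabs_Cmod_pow.
  - apply CV_disk_inside. rewrite Rabs_pos_eq by lra.
    apply Rbar_lt_le_trans with ((rho + r) / 2); [simpl; lra | apply H; lra].
Qed.

Lemma CV_radius_summable (a : nat -> C) (r rho : R) :
  summable_within a r -> 0 <= rho < r ->
  Rbar_le rho (CV_radius (fun n => Cmod (a n))).
Proof.
  intros H Hrho. apply (proj1 (CV_radius_bounded _)).
  destruct (filterlim_bounded (K := R_AbsRing) (V := R_NormedModule)
              (fun n => Cmod (a n) * rho ^ n)) as [M HM].
  { exists 0. apply ex_series_lim_0, H, Hrho. }
  exists M. exact HM.
Qed.

(** A series converging at a point has bounded terms there, hence converges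
    absolutely at every point closer to the centre. *)
Lemma pseries_summable (a : nat -> C) (r : R) (F : C -> C) :
  (forall w, Cmod w < r -> Cseries (fun n => a n * w ^ n)%C (F w)) ->
  summable_within a r.
Proof.
  intros H. apply summable_within_CV_radius. intros rho Hrho.
  apply (proj1 (CV_radius_bounded _)).
  assert (Hr : Cmod rho < r) by (rewrite Cmod_R, Rabs_pos_eq; lra).
  pose proof (H rho Hr) as Hs.
  destruct (filterlim_bounded (K := C_AbsRing) (V := C_NormedModule)
              (sum_n (G := C_AbelianMonoid) (fun n => a n * rho ^ n)%C)) as [M HM].
  { now exists (F rho). }
  change (forall n, Cmod (sum_n (G := C_AbelianMonoid)
            (fun n => a n * rho ^ n)%C n) <= M) in HM.
  exists (M + M). intros n. rewrite Rabs_Cmod_pow by lra.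
  replace (Cmod (a n) * rho ^ n) with (Cmod (a n * rho ^ n)%C)
    by (rewrite Cmod_mult, Cmod_pow, Cmod_R, Rabs_pos_eq by lra; reflexivity).
  destruct n as [|n].
  - specialize (HM O). rewrite sum_O in HM.
    pose proof (Cmod_ge_0 (a O * rho ^ 0)%C). lra.
  - pose proof (HM n) as H1. pose proof (HM (S n)) as H2.
    rewrite sum_Sn in H2.
    set (s := sum_n (G := C_AbelianMonoid) _ n) in *.
    change (Cmod (s + a (S n) * rho ^ S n)%C <= M) in H2.
    replace (a (S n) * rho ^ S n)%C
      with ((s + a (S n) * rho ^ S n) + - s)%C by ring.
    eapply Rle_trans; [apply Cmod_triangle|]. rewrite Cmod_opp. lra.
Qed.

Definition dcoef (a : nat -> C) (n : nat) : C := (INR (S n) * a (S n))%C.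

Lemma dcoef_summable (a : nat -> C) (r : R) :
  summable_within a r -> summable_within (dcoef a) r.
Proof.
  intros H. apply summable_within_CV_radius. intros rho Hrho.
  rewrite (CV_radius_ext _ (PS_derive (fun n => Cmod (a n)))).
  - rewrite CV_radius_derive. exact (CV_radius_summable a r rho H Hrho).
  - intros n. unfold dcoef, PS_derive. rewrite Cmod_mult, Cmod_R, Rabs_pos_eq.
    + reflexivity.
    + apply pos_INR.
Qed.

Lemma shift_summable (a : nat -> C) (r : R) :
  summable_within a r -> summable_within (fun n => a (S n)) r.
Proof.
  intros H. apply summable_within_CV_radius. intros rho Hrho.
  rewrite (CV_radius_ext _ (PS_decr_1 (fun n => Cmod (a n)))).
  - rewrite CV_radius_decr_1. exact (CV_radius_summable a r rho H Hrho).
  - reflexivity.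
Qed.

Lemma psum_shift (a : nat -> C) (r : R) (w : C) :
  summable_within a r -> Cmod w < r ->
  psum a w = (a O + w * psum (fun n => a (S n)) w)%C.
Proof.
  intros Ha Hw. apply psum_unique.
  replace (a O) with (a O * w ^ 0)%C by (simpl; ring).
  apply (Cseries_cons (fun n => a n * w ^ n)%C).
  apply (Cseries_ext (fun n => w * (a (S n) * w ^ n))%C).
  - intros n. rewrite Cpow_S. ring.
  - apply Cseries_scal, (psum_correct (fun n => a (S n)) r); [|exact Hw].
    now apply shift_summable.
Qed.

Lemma psum_0 (a : nat -> C) : psum a 0 = a O.
Proof.
  apply psum_unique.
  replace (a O) with (a O * 0 ^ 0 + 0)%C by (simpl; ring).
  apply (Cseries_cons (fun n => a n * 0 ^ n)%C).
  apply (Cseries_ext (fun _ => RtoC 0)); [|exact Cseries_zero].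
  intros n. rewrite Cpow_S. ring.
Qed.


(** * Local expansions *)

Definition bigO (n : nat) (E : C -> C) : Prop :=
  exists K delta, 0 <= K /\ 0 < delta /\
    forall h, Cmod h < delta -> Cmod (E h) <= K * Cmod h ^ n.

Lemma bigO_ext (n : nat) (E E' : C -> C) (d : R) :
  0 < d -> (forall h, Cmod h < d -> E h = E' h) -> bigO n E -> bigO n E'.
Proof.
  intros Hd Heq (K & delta & HK & Hdelta & H).
  exists K, (Rmin delta d). split; [exact HK|]. split; [now apply Rmin_glb_lt|].
  intros h Hh. rewrite <- Heq.
  - apply H. eapply Rlt_le_trans; [exact Hh | apply Rmin_l].
  - eapply Rlt_le_trans; [exact Hh | apply Rmin_r].
Qed.

Lemma bigO_plus (n : nat) (E E' : C -> C) :
  bigO n E -> bigO n E' -> bigO n (fun h => E h + E' h)%C.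
Proof.
  intros (K & d & HK & Hd & H) (K' & d' & HK' & Hd' & H').
  exists (K + K'), (Rmin d d').
  split; [lra|]. split; [now apply Rmin_glb_lt|].
  intros h Hh. eapply Rle_trans; [apply Cmod_triangle|].
  rewrite Rmult_plus_distr_r. apply Rplus_le_compat.
  - apply H. eapply Rlt_le_trans; [exact Hh | apply Rmin_l].
  - apply H'. eapply Rlt_le_trans; [exact Hh | apply Rmin_r].
Qed.

Lemma bigO_mult (n m : nat) (E E' : C -> C) :
  bigO n E -> bigO m E' -> bigO (n + m) (fun h => E h * E' h)%C.
Proof.
  intros (K & d & HK & Hd & H) (K' & d' & HK' & Hd' & H').
  exists (K * K'), (Rmin d d').
  split; [now apply Rmult_le_pos|]. split; [now apply Rmin_glb_lt|].
  intros h Hh. rewrite Cmod_mult, pow_add.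
  replace (K * K' * (Cmod h ^ n * Cmod h ^ m))
    with ((K * Cmod h ^ n) * (K' * Cmod h ^ m)) by ring.
  apply Rmult_le_compat; try apply Cmod_ge_0.
  - apply H. eapply Rlt_le_trans; [exact Hh | apply Rmin_l].
  - apply H'. eapply Rlt_le_trans; [exact Hh | apply Rmin_r].
Qed.

Lemma bigO_const (c : C) : bigO 0 (fun _ => c).
Proof.
  exists (Cmod c), 1. split; [apply Cmod_ge_0|]. split; [lra|].
  intros h _. simpl. lra.
Qed.

Lemma bigO_pow (n : nat) : bigO n (fun h => h ^ n)%C.
Proof.
  exists 1, 1. split; [lra|]. split; [lra|]. intros h _. rewrite Cmod_pow. lra.
Qed.

Lemma bigO_weaken (n m : nat) (E : C -> C) : (m <= n)%nat -> bigO n E -> bigO m E.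
Proof.
  intros Hmn (K & d & HK & Hd & H). exists K, (Rmin d 1).
  split; [exact HK|]. split; [apply Rmin_glb_lt; lra|].
  intros h Hh. eapply Rle_trans; [apply H|].
  - eapply Rlt_le_trans; [exact Hh | apply Rmin_l].
  - apply Rmult_le_compat_l; [exact HK|].
    replace n with ((n - m) + m)%nat by lia. rewrite pow_add.
    rewrite <- (Rmult_1_l (Cmod h ^ m)) at 2.
    apply Rmult_le_compat_r; [apply pow_le, Cmod_ge_0|].
    rewrite <- (pow1 (n - m)). apply pow_incr. split; [apply Cmod_ge_0|].
    apply Rlt_le. eapply Rlt_le_trans; [exact Hh | apply Rmin_r].
Qed.

Lemma bigO_scal (n : nat) (c : C) (E : C -> C) :
  bigO n E -> bigO n (fun h => c * E h)%C.
Proof. intros H. exact (bigO_mult 0 n _ _ (bigO_const c) H). Qed.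

Lemma bigO_monomial (n : nat) (c : C) : bigO n (fun h => c * h ^ n)%C.
Proof. apply bigO_scal, bigO_pow. Qed.

Lemma bigO_comp_scal (n : nat) (k : C) (E : C -> C) :
  bigO n E -> bigO n (fun h => E (k * h))%C.
Proof.
  intros (K & d & HK & Hd & H).
  assert (Hk : 0 < Cmod k + 1) by (pose proof (Cmod_ge_0 k); lra).
  exists (K * Cmod k ^ n), (d / (Cmod k + 1)).
  split; [apply Rmult_le_pos; [exact HK | apply pow_le, Cmod_ge_0]|].
  split; [now apply Rdiv_lt_0_compat|].
  intros h Hh. rewrite Rmult_assoc, <- Rpow_mult_distr, <- Cmod_mult.
  apply H. rewrite Cmod_mult. pose proof (Cmod_ge_0 h).
  apply Rle_lt_trans with ((Cmod k + 1) * Cmod h).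
  - apply Rmult_le_compat_r; lra.
  - apply Rmult_lt_compat_l with (r := Cmod k + 1) in Hh; [|exact Hk].
    eapply Rlt_le_trans; [exact Hh|]. right. field. lra.
Qed.

Lemma bigO_near_nonzero (E : C -> C) (d0 : C) :
  d0 <> 0 -> bigO 1 (fun h => E h - d0)%C ->
  exists d, 0 < d /\ forall h, Cmod h < d -> E h <> 0.
Proof.
  intros Hd0 (K & d & HK & Hd & H). apply Cmod_gt_0 in Hd0.
  exists (Rmin d (Cmod d0 / (K + 1))).
  split; [apply Rmin_glb_lt; [lra | apply Rdiv_lt_0_compat; lra]|].
  intros h Hh E0.
  assert (H1 : Cmod h < d) by (eapply Rlt_le_trans; [exact Hh | apply Rmin_l]).
  assert (H2 : Cmod h < Cmod d0 / (K + 1))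
    by (eapply Rlt_le_trans; [exact Hh | apply Rmin_r]).
  apply H in H1. rewrite E0 in H1.
  replace (0 - d0)%C with (- d0)%C in H1 by ring.
  rewrite Cmod_opp in H1. simpl in H1.
  apply Rmult_lt_compat_r with (r := K + 1) in H2; [|lra].
  replace (Cmod d0 / (K + 1) * (K + 1)) with (Cmod d0) in H2 by (field; lra).
  pose proof (Cmod_ge_0 h). nra.
Qed.

Lemma bigO_inv (E : C -> C) (d0 : C) :
  d0 <> 0 -> bigO 1 (fun h => E h - d0)%C -> bigO 0 (fun h => / E h)%C.
Proof.
  intros Hd0 (K & d & HK & Hd & H). apply Cmod_gt_0 in Hd0.
  exists (2 / Cmod d0), (Rmin d (Cmod d0 / (2 * (K + 1)))).
  split; [apply Rlt_le, Rdiv_lt_0_compat; lra|].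
  split; [apply Rmin_glb_lt; [lra | apply Rdiv_lt_0_compat; lra]|].
  intros h Hh. simpl.
  assert (Hh1 : Cmod h < d) by (eapply Rlt_le_trans; [exact Hh | apply Rmin_l]).
  assert (Hh2 : Cmod h < Cmod d0 / (2 * (K + 1)))
    by (eapply Rlt_le_trans; [exact Hh | apply Rmin_r]).
  apply H in Hh1. simpl in Hh1.
  apply Rmult_lt_compat_r with (r := 2 * (K + 1)) in Hh2; [|lra].
  replace (Cmod d0 / (2 * (K + 1)) * (2 * (K + 1))) with (Cmod d0) in Hh2
    by (field; lra).
  pose proof (Cmod_ge_0 h).
  assert (Hlow : Cmod d0 / 2 <= Cmod (E h)).
  { pose proof (Cmod_triangle (E h) (- (E h - d0))%C) as Ht.
    rewrite Cmod_opp in Ht.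
    replace (E h + - (E h - d0))%C with d0 in Ht by ring. nra. }
  rewrite Cmod_inv by (apply Cmod_gt_0; lra).
  rewrite Rmult_1_r.
  replace (2 / Cmod d0) with (/ (Cmod d0 / 2)) by (field; lra).
  apply Rinv_le_contravar; lra.
Qed.

(** Quadratic remainders, rather than the weaker o(h), are what power series
    give; they keep the calculus algebraic. *)
Definition cderiv (F : C -> C) (z l : C) : Prop :=
  bigO 2 (fun h => F (z + h) - F z - h * l)%C.

Lemma cderiv_C_derive (F : C -> C) (z l : C) : cderiv F z l -> C_derive F z = l.
Proof.
  intros (K & d & HK & Hd & H). apply is_C_derive_unique. split.
  { apply (is_linear_scal_l (K := C_AbsRing) (V := C_NormedModule)). }
  intros x Hx.
  apply (is_filter_lim_locally_unique (K := C_AbsRing)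
           (V := AbsRing_NormedModule C_AbsRing)) in Hx. subst x.
  intros eps.
  set (del := Rmin d (eps / (K + 1))).
  assert (Hdel : 0 < del).
  { apply Rmin_glb_lt; [exact Hd|]. apply Rdiv_lt_0_compat; [apply cond_pos | lra]. }
  exists (mkposreal del Hdel).
  change (forall y : C, Cmod (y - z)%C < del ->
            Cmod ((F y - F z) - (y - z) * l)%C <= eps * Cmod (y - z)%C).
  intros y Hy.
  assert (H1 : Cmod (y - z) < d)
    by (eapply Rlt_le_trans; [exact Hy | apply Rmin_l]).
  assert (H2 : Cmod (y - z) < eps / (K + 1))
    by (eapply Rlt_le_trans; [exact Hy | apply Rmin_r]).
  apply H in H1. replace (z + (y - z))%C with y in H1 by ring.
  eapply Rle_trans; [exact H1|].
  apply Rmult_lt_compat_r with (r := K + 1) in H2; [|lra].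
  replace (eps / (K + 1) * (K + 1)) with (pos eps) in H2 by (field; lra).
  pose proof (Cmod_ge_0 (y - z)). nra.
Qed.

Lemma cderiv_ext (F G : C -> C) (z l : C) (d : R) :
  0 < d -> (forall w, Cmod (w - z) < d -> F w = G w) ->
  cderiv F z l -> cderiv G z l.
Proof.
  intros Hd Heq. apply (bigO_ext 2 _ _ d Hd). intros h Hh.
  rewrite !Heq; [reflexivity| |].
  - replace (z - z)%C with (RtoC 0) by ring. now rewrite Cmod_0.
  - now replace (z + h - z)%C with h by ring.
Qed.

Lemma cderiv_continuous (F : C -> C) (z l : C) :
  cderiv F z l -> bigO 1 (fun h => F (z + h) - F z)%C.
Proof.
  intros H. apply (bigO_ext 1 (fun h => (F (z + h) - F z - h * l) + l * h ^ 1)%C _ 1);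
    [lra | intros h _; simpl; ring |].
  apply bigO_plus; [|apply bigO_monomial].
  apply (bigO_weaken 2); [lia | exact H].
Qed.

Lemma cderiv_bounded (F : C -> C) (z l : C) :
  cderiv F z l -> bigO 0 (fun h => F (z + h)%C).
Proof.
  intros H. apply (bigO_ext 0 (fun h => (F (z + h) - F z) + F z)%C _ 1);
    [lra | intros h _; ring |].
  apply bigO_plus; [|apply bigO_const].
  apply (bigO_weaken 1); [lia | exact (cderiv_continuous F z l H)].
Qed.

Lemma cderiv_affine (F : C -> C) (z l p q : C) :
  cderiv F z l -> cderiv (fun w => p * F w + q)%C z (p * l)%C.
Proof.
  intros H. apply (bigO_ext 2 (fun h => p * (F (z + h) - F z - h * l))%C _ 1);
    [lra | intros h _; ring |].
  now apply bigO_scal.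
Qed.

Lemma cderiv_mult (F G : C -> C) (z l m : C) :
  cderiv F z l -> cderiv G z m ->
  cderiv (fun w => F w * G w)%C z (l * G z + F z * m)%C.
Proof.
  intros HF HG.
  apply (bigO_ext 2 (fun h => (F (z + h) - F z - h * l) * G (z + h)
     + (F z * (G (z + h) - G z - h * m) + l * (h ^ 1 * (G (z + h) - G z))))%C _ 1);
    [lra | intros h _; simpl; ring |].
  apply bigO_plus; [|apply bigO_plus].
  - exact (bigO_mult 2 0 _ _ HF (cderiv_bounded G z m HG)).
  - now apply bigO_scal.
  - apply bigO_scal.
    exact (bigO_mult 1 1 _ _ (bigO_pow 1) (cderiv_continuous G z m HG)).
Qed.

Lemma cderiv_comp_shift (F : C -> C) (z l q : C) :
  cderiv F (z + q) l -> cderiv (fun w => F (w + q))%C z l.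
Proof.
  intros H. eapply bigO_ext; [exact Rlt_0_1 | | exact H].
  intros h _. cbv beta. now replace (z + q + h)%C with (z + h + q)%C by ring.
Qed.

Lemma cderiv_comp_scal (F : C -> C) (z l p : C) :
  cderiv F (p * z) l -> cderiv (fun w => F (p * w))%C z (p * l)%C.
Proof.
  intros H.
  apply (bigO_ext 2 (fun h => F (p * z + p * h) - F (p * z) - p * h * l)%C _ 1);
    [lra | |].
  - intros h _. rewrite Cmult_plus_distr_l. ring.
  - exact (bigO_comp_scal 2 p (fun h => F (p * z + h) - F (p * z) - h * l)%C H).
Qed.

Lemma cderiv_inv_linear (c z : C) :
  (1 - c * z <> 0)%C ->
  cderiv (fun w => / (1 - c * w))%C z (c / ((1 - c * z) * (1 - c * z)))%C.
Proof.
  intros Hz.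
  assert (Hlin : bigO 1 (fun h => (1 - c * (z + h)) - (1 - c * z))%C).
  { apply (bigO_ext 1 (fun h => (- c) * h ^ 1)%C _ 1);
      [lra | intros h _; simpl; ring | apply bigO_monomial]. }
  destruct (bigO_near_nonzero _ _ Hz Hlin) as (d & Hd & Hne).
  apply (bigO_ext 2 (fun h => (c * c / ((1 - c * z) * (1 - c * z)) * h ^ 2)
           * / (1 - c * (z + h)))%C _ d Hd).
  - intros h Hh. specialize (Hne h Hh). simpl. field. split; assumption.
  - apply (bigO_mult 2 0); [apply bigO_monomial|].
    exact (bigO_inv _ _ Hz Hlin).
Qed.

(** On the segment from 0 to w, F is a function of a real variable with zero
    derivative. *)
Lemma cderiv_null_constant (F : C -> C) (r : R) (w : C) :
  (forall z, Cmod z < r -> cderiv F z 0) -> Cmod w < r -> F w = F 0.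
Proof.
  intros H Hw.
  assert (Hseg : forall t, 0 <= t <= 1 ->
     is_derive (K := R_AbsRing) (V := C_R_NormedModule) (fun t : R => F (t * w)%C) t zero).
  { intros t Ht.
    assert (Htw : Cmod (t * w) < r).
    { rewrite Cmod_mult, Cmod_R, Rabs_pos_eq by lra.
      pose proof (Cmod_ge_0 w). nra. }
    destruct (H _ Htw) as (K & d & HK & Hd & HF).
    split; [apply (is_linear_scal_l (K := R_AbsRing) (V := C_R_NormedModule))|].
    intros s Hs.
    apply (is_filter_lim_locally_unique (K := R_AbsRing)
             (V := AbsRing_NormedModule R_AbsRing)) in Hs. subst s.
    intros eps. pose proof (Cmod_ge_0 w) as Hw0. pose proof (cond_pos eps) as Heps.
    set (del := Rmin (d / (Cmod w + 1)) (eps / (K * Cmod w ^ 2 + 1))).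
    assert (HKw : 0 <= K * Cmod w ^ 2)
      by (apply Rmult_le_pos; [exact HK | apply pow_le, Hw0]).
    assert (Hdel : 0 < del) by (apply Rmin_glb_lt; apply Rdiv_lt_0_compat; lra).
    exists (mkposreal del Hdel).
    assert (Hnorm : forall x : C, norm (V := C_R_NormedModule) x = Cmod x).
    { intros [a b]. unfold Cmod. simpl fst. simpl snd.
      rewrite <- (pow2_abs a), <- (pow2_abs b). reflexivity. }
    change (forall y : R, Rabs (y - t) < del ->
      norm (V := C_R_NormedModule) ((F (y * w) - F (t * w)) - ((y - t) * 0, (y - t) * 0)%R)%C
        <= eps * Rabs (y - t)).
    intros y Hy. rewrite Hnorm.
    replace ((y - t) * 0, (y - t) * 0)%R with (RtoC 0)
      by (unfold RtoC; f_equal; ring).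
    assert (H1 : Rabs (y - t) < d / (Cmod w + 1))
      by (eapply Rlt_le_trans; [exact Hy | apply Rmin_l]).
    assert (H2 : Rabs (y - t) < eps / (K * Cmod w ^ 2 + 1))
      by (eapply Rlt_le_trans; [exact Hy | apply Rmin_r]).
    apply Rmult_lt_compat_r with (r := Cmod w + 1) in H1; [|lra].
    replace (d / (Cmod w + 1) * (Cmod w + 1)) with d in H1 by (field; lra).
    apply Rmult_lt_compat_r with (r := K * Cmod w ^ 2 + 1) in H2; [|lra].
    replace (eps / (K * Cmod w ^ 2 + 1) * (K * Cmod w ^ 2 + 1))
      with (pos eps) in H2 by (field; lra).
    pose proof (Rabs_pos (y - t)) as Hyt.
    assert (Hh : Cmod ((y - t)%R * w) < d).
    { rewrite Cmod_mult, Cmod_R. nra. }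
    apply HF in Hh. rewrite Cmod_mult, Cmod_R in Hh.
    replace (t * w + (y - t)%R * w)%C with (y * w)%C in Hh
      by (rewrite RtoC_minus; ring).
    replace (F (y * w) - F (t * w) - 0)%C
      with (F (y * w) - F (t * w) - (y - t)%R * w * 0)%C by ring.
    eapply Rle_trans; [exact Hh|].
    replace (K * (Rabs (y - t) * Cmod w) ^ 2)
      with (K * Cmod w ^ 2 * Rabs (y - t) * Rabs (y - t)) by ring.
    apply Rmult_le_compat_r; [exact Hyt|]. nra. }
  pose proof (eq_is_derive (V := C_R_NormedModule) (fun t : R => F (t * w)%C) 0 1 Hseg
    Rlt_0_1) as E. cbv beta in E.
  rewrite Cmult_0_l, Cmult_1_l in E. now symmetry.
Qed.


(** * Differentiation of power series *)

Lemma Cseries_tail (a : nat -> C) (l : C) :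
  Cseries a l -> Cseries (fun n => a (S n)) (l - a O)%C.
Proof.
  intros H. apply (is_series_incr_1 (K := C_AbsRing) (V := C_NormedModule)).
  eapply eq_ind; [exact H|].
  change (l = (l - a O) + a O)%C. ring.
Qed.

Lemma Cpow_remainder (w h : C) (rho : R) (n : nat) :
  Cmod w <= rho -> Cmod (w + h) <= rho ->
  Cmod ((w + h) ^ S (S n) - w ^ S (S n) - h * (INR (S (S n)) * w ^ S n))%C
    <= Cmod h ^ 2 * (INR (S n) * INR (S (S n)) * rho ^ n).
Proof.
  intros Hw Hwh.
  induction n as [|n IH].
  - simpl INR. simpl Cpow. rewrite RtoC_plus.
    replace ((w + h) * ((w + h) * 1) - w * (w * 1) - h * ((1 + 1) * (w * 1)))%C
      with (h * h)%C by ring.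
    rewrite Cmod_mult. simpl. pose proof (Cmod_ge_0 h). nra.
  - set (m := S (S n)) in *.
    replace ((w + h) ^ S m - w ^ S m - h * (INR (S m) * w ^ m))%C
      with ((w + h) * ((w + h) ^ m - w ^ m - h * (INR m * w ^ S n))
            + h * h * (INR m * w ^ S n))%C.
    2:{ rewrite (S_INR m), RtoC_plus. unfold m. rewrite !Cpow_S. ring. }
    eapply Rle_trans; [apply Cmod_triangle|].
    rewrite !Cmod_mult, Cmod_pow, Cmod_R, (Rabs_pos_eq (INR m)) by apply pos_INR.
    assert (H1 : Cmod w ^ S n <= rho ^ S n)
      by (apply pow_incr; split; [apply Cmod_ge_0 | exact Hw]).
    pose proof (Cmod_ge_0 h) as Hh. pose proof (Cmod_ge_0 (w + h)) as Hp.
    pose proof (pos_INR m) as Hm. pose proof (pos_INR n) as Hn.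
    assert (H2 : Cmod (w + h) * Cmod ((w + h) ^ m - w ^ m - h * (INR m * w ^ S n))
              <= rho * (Cmod h ^ 2 * (INR (S n) * INR m * rho ^ n)))
      by (apply Rmult_le_compat; try apply Cmod_ge_0; assumption).
    assert (H3 : Cmod h * Cmod h * (INR m * Cmod w ^ S n)
              <= Cmod h * Cmod h * (INR m * rho ^ S n)).
    { apply Rmult_le_compat_l; [nra|]. apply Rmult_le_compat_l; assumption. }
    eapply Rle_trans; [apply Rplus_le_compat; [exact H2 | exact H3]|].
    assert (Hr : 0 <= rho ^ S n)
      by (apply pow_le; pose proof (Cmod_ge_0 w); lra).
    replace (rho * (Cmod h ^ 2 * (INR (S n) * INR m * rho ^ n))
             + Cmod h * Cmod h * (INR m * rho ^ S n))
      with ((Cmod h ^ 2 * rho ^ S n) * (INR (S n) * INR m + INR m))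
      by (simpl; ring).
    replace (Cmod h ^ 2 * (INR m * INR (S m) * rho ^ S n))
      with ((Cmod h ^ 2 * rho ^ S n) * (INR m * INR (S m))) by ring.
    apply Rmult_le_compat_l.
    + apply Rmult_le_pos; [apply pow2_ge_0 | exact Hr].
    + rewrite (S_INR m). unfold m. rewrite !S_INR. nra.
Qed.

(** Termwise, (w+h)^n - w^n - n h w^(n-1) is O(n^2 |h|^2 rho^(n-2)), and the
    twice differentiated series, which has the same radius of convergence,
    sums these errors. *)
Lemma psum_cderiv (a : nat -> C) (r : R) (w : C) :
  summable_within a r -> Cmod w < r -> cderiv (psum a) w (psum (dcoef a) w).
Proof.
  intros Ha Hw.
  set (rho := (Cmod w + r) / 2).
  pose proof (Cmod_ge_0 w) as Hw0.
  set (b := fun n => Cmod (dcoef (dcoef a) n) * rho ^ n).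
  assert (Hb : is_series b (Series b)).
  { apply Series_correct, (dcoef_summable (dcoef a) r);
      [now apply dcoef_summable | unfold rho; lra]. }
  assert (Hb0 : 0 <= Series b).
  { rewrite <- Cmod_0. apply (Cseries_le (fun _ => RtoC 0) b 0); [| |exact Hb].
    - intros n. rewrite Cmod_0. unfold b.
      apply Rmult_le_pos; [apply Cmod_ge_0 | apply pow_le; unfold rho; lra].
    - exact Cseries_zero. }
  exists (Series b), (rho - Cmod w).
  split; [exact Hb0|]. split; [unfold rho; lra|].
  intros h Hh.
  assert (Hwh : Cmod (w + h) < rho)
    by (pose proof (Cmod_triangle w h); lra).
  assert (S1 := psum_correct a r (w + h) Ha ltac:(unfold rho in *; lra)).
  assert (S2 := psum_correct a r w Ha Hw).
  assert (S3 := psum_correct (dcoef a) r w (dcoef_summable a r Ha) Hw).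
  pose proof (Cseries_tail _ _ (Cseries_minus _ _ _ _ S1 S2)) as S4.
  pose proof (Cseries_minus _ _ _ _ S4 (Cseries_scal h _ _ S3)) as S5.
  pose proof (Cseries_tail _ _ S5) as S6. cbv beta in S6.
  pose proof (is_series_scal (Cmod h ^ 2) b (Series b) Hb) as S7.
  match type of S6 with
  | Cseries _ ?l =>
      replace (psum a (w + h) - psum a w - h * psum (dcoef a) w)%C with l
  end.
  2:{ unfold dcoef at 2. simpl. ring. }
  rewrite (Rmult_comm (Series b)).
  refine (Cseries_le _ _ _ _ _ S6 S7).
  intros n. change (scal (Cmod h ^ 2) (b n)) with (Cmod h ^ 2 * b n).
  unfold b, dcoef at 2.
  replace (_ - _)%C with (a (S (S n)) *
     ((w + h) ^ S (S n) - w ^ S (S n) - h * (INR (S (S n)) * w ^ S n)))%C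
    by (unfold dcoef; ring).
  unfold dcoef. rewrite !Cmod_mult, !Cmod_R, !(Rabs_pos_eq (INR _)) by apply pos_INR.
  replace (Cmod h ^ 2 * (INR (S n) * (INR (S (S n)) * Cmod (a (S (S n)))) * rho ^ n))
    with (Cmod (a (S (S n))) * (Cmod h ^ 2 * (INR (S n) * INR (S (S n)) * rho ^ n)))
    by ring.
  apply Rmult_le_compat_l; [apply Cmod_ge_0|].
  apply Cpow_remainder; unfold rho in *; lra.
Qed.

(** * Second order jets *)

(** Order two is what the averaging argument in the maximum principle uses. *)
Definition jet2 (F : C -> C) (z c0 c1 c2 : C) : Prop :=
  bigO 3 (fun h => F (z + h) - (c0 + c1 * h + c2 * (h * h)))%C.

Definition has_jet2 (F : C -> C) (z : C) : Prop :=
  exists c0 c1 c2, jet2 F z c0 c1 c2.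

Lemma jet2_value (F : C -> C) (z c0 c1 c2 : C) : jet2 F z c0 c1 c2 -> F z = c0.
Proof.
  intros (K & d & HK & Hd & H). specialize (H (RtoC 0)).
  rewrite Cmod_0 in H. specialize (H Hd).
  replace (z + 0)%C with z in H by ring.
  replace (F z) with ((F z - (c0 + c1 * 0 + c2 * (0 * 0))) + c0)%C by ring.
  rewrite (Cmod_eq_0 (F z - (c0 + c1 * 0 + c2 * (0 * 0)))%C); [ring|].
  apply Rle_antisym; [|apply Cmod_ge_0]. simpl in H. lra.
Qed.

Lemma jet2_continuous (F : C -> C) (z c0 c1 c2 : C) :
  jet2 F z c0 c1 c2 -> bigO 1 (fun h => F (z + h) - c0)%C.
Proof.
  intros H.
  apply (bigO_ext 1 (fun h => (F (z + h) - (c0 + c1 * h + c2 * (h * h)))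
            + (c1 * h ^ 1 + c2 * h ^ 2))%C _ 1);
    [lra | intros h _; simpl; ring |].
  apply bigO_plus; [apply (bigO_weaken 3); [lia | exact H]|].
  apply bigO_plus; [apply bigO_monomial|].
  apply (bigO_weaken 2); [lia | apply bigO_monomial].
Qed.

Lemma jet2_bounded (F : C -> C) (z c0 c1 c2 : C) :
  jet2 F z c0 c1 c2 -> bigO 0 (fun h => F (z + h))%C.
Proof.
  intros H. apply (bigO_ext 0 (fun h => (F (z + h) - c0) + c0)%C _ 1);
    [lra | intros h _; ring |].
  apply bigO_plus; [|apply bigO_const].
  apply (bigO_weaken 1); [lia | exact (jet2_continuous F z c0 c1 c2 H)].
Qed.

Lemma has_jet2_id (z : C) : has_jet2 (fun w => w) z.
Proof.
  exists z, 1, 0. apply (bigO_ext 3 (fun h => 0 * h ^ 3)%C _ 1);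
    [lra | intros h _; ring | apply bigO_monomial].
Qed.

Lemma has_jet2_const (c z : C) : has_jet2 (fun _ => c) z.
Proof.
  exists c, 0, 0. apply (bigO_ext 3 (fun h => 0 * h ^ 3)%C _ 1);
    [lra | intros h _; ring | apply bigO_monomial].
Qed.

Lemma has_jet2_plus (F G : C -> C) (z : C) :
  has_jet2 F z -> has_jet2 G z -> has_jet2 (fun w => F w + G w)%C z.
Proof.
  intros (a & b & c & H) (a' & b' & c' & H').
  exists (a + a')%C, (b + b')%C, (c + c')%C.
  eapply bigO_ext; [exact Rlt_0_1 | | exact (bigO_plus 3 _ _ H H')].
  intros h _. cbv beta. ring.
Qed.

Lemma has_jet2_mult (F G : C -> C) (z : C) :
  has_jet2 F z -> has_jet2 G z -> has_jet2 (fun w => F w * G w)%C z.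
Proof.
  intros (a & b & c & H) (a' & b' & c' & H').
  exists (a * a')%C, (a * b' + b * a')%C, (a * c' + b * b' + c * a')%C.
  pose proof (bigO_mult 3 0 _ _ H (jet2_bounded G z a' b' c' H')) as T1.
  assert (P0 : bigO 0 (fun h => a + b * h ^ 1 + c * h ^ 2)%C).
  { apply bigO_plus; [apply bigO_plus; [apply bigO_const|]|].
    - apply (bigO_weaken 1); [lia | apply bigO_monomial].
    - apply (bigO_weaken 2); [lia | apply bigO_monomial]. }
  pose proof (bigO_mult 0 3 _ _ P0 H') as T2.
  pose proof (bigO_monomial 3 (b * c' + c * b')) as T3.
  pose proof (bigO_weaken 4 3 _ ltac:(lia) (bigO_monomial 4 (c * c'))) as T4.
  eapply bigO_ext;
    [exact Rlt_0_1 | | exact (bigO_plus 3 _ _ (bigO_plus 3 _ _ T1 T2)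
                                (bigO_plus 3 _ _ T3 T4))].
  intros h _. cbv beta. simpl. ring.
Qed.

Lemma has_jet2_inv (G : C -> C) (z : C) :
  has_jet2 G z -> G z <> 0 -> has_jet2 (fun w => / G w)%C z.
Proof.
  intros (a & b & c & H) Hz.
  rewrite (jet2_value G z a b c H) in Hz.
  pose proof (jet2_continuous G z a b c H) as Hc.
  destruct (bigO_near_nonzero _ a Hz Hc) as (d & Hd & Hne).
  pose proof (bigO_inv _ a Hz Hc) as Hinv.
  (* the coefficients of 1/(a + b h + c h^2), found by undetermined coefficients *)
  set (p := (/ a)%C). set (q := (- b / (a * a))%C).
  set (s := ((b * b - a * c) / (a * a * a))%C).
  exists p, q, s.
  assert (P0 : bigO 0 (fun h => p + q * h ^ 1 + s * h ^ 2)%C).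
  { apply bigO_plus; [apply bigO_plus; [apply bigO_const|]|].
    - apply (bigO_weaken 1); [lia | apply bigO_monomial].
    - apply (bigO_weaken 2); [lia | apply bigO_monomial]. }
  pose proof (bigO_scal _ (-1)%C _ (bigO_mult 0 3 _ _ P0 H)) as T1.
  pose proof (bigO_monomial 3 (- (b * s + c * q))) as T2.
  pose proof (bigO_weaken 4 3 _ ltac:(lia) (bigO_monomial 4 (- (c * s)))) as T3.
  pose proof (bigO_mult 0 3 _ _ Hinv
     (bigO_plus 3 _ _ (bigO_plus 3 _ _ T1 T2) T3)) as T.
  eapply bigO_ext; [exact Hd | | exact T].
  intros h Hh. specialize (Hne h Hh). cbv beta. unfold p, q, s. simpl.
  field. split; assumption.
Qed.

Lemma has_jet2_ext (F G : C -> C) (z : C) (d : R) :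
  0 < d -> (forall w, Cmod (w - z) < d -> F w = G w) ->
  has_jet2 F z -> has_jet2 G z.
Proof.
  intros Hd Heq (a & b & c & H). exists a, b, c.
  apply (bigO_ext 3 _ _ d Hd) with (2 := H). intros h Hh.
  rewrite Heq; [reflexivity|]. now replace (z + h - z)%C with h by ring.
Qed.

Lemma psum_jet2 (a : nat -> C) (r : R) (z : C) :
  0 < r -> summable_within a r -> has_jet2 (fun w => psum a (w - z)) z.
Proof.
  intros Hr Ha. exists (a 0%nat), (a 1%nat), (a 2%nat).
  pose proof (shift_summable _ _ Ha) as H1.
  pose proof (shift_summable _ _ H1) as H2.
  pose proof (shift_summable _ _ H2) as H3. cbv beta in H2, H3.
  assert (Hr0 : Cmod 0 < r) by (now rewrite Cmod_0).
  pose proof (cderiv_bounded _ _ _ (psum_cderiv _ r 0 H3 Hr0)) as Hb.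
  apply (bigO_ext 3 (fun h => h ^ 3 * psum (fun n => a (S (S (S n)))) (0 + h))%C _ r Hr).
  - intros h Hh. replace (0 + h)%C with h by ring.
    replace (z + h - z)%C with h by ring.
    rewrite (psum_shift a r h Ha Hh), (psum_shift _ r h H1 Hh),
      (psum_shift _ r h H2 Hh). simpl. ring.
  - apply (bigO_mult 3 0); [apply bigO_pow | exact Hb].
Qed.

(** * Analytic functions *)

Definition expands_at (f : C -> C) (z0 : C) (a : nat -> C) (r : R) : Prop :=
  0 < r /\ summable_within a r /\
  forall z, Cmod (z - z0) < r -> f z = psum a (z - z0).

Lemma analytic_expands (f : C -> C) (z0 : C) :
  analytic_in_disk f -> in_disk z0 -> exists a r, expands_at f z0 a r.
Proof.
  intros Hf Hz0. destruct (Hf z0 Hz0) as (a & r & Hr & H).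
  assert (Hs : forall w, Cmod w < r -> Cseries (fun n => a n * w ^ n)%C (f (z0 + w)%C)).
  { intros w Hw. apply is_pseries_Cseries.
    specialize (H (z0 + w)%C). replace (z0 + w - z0)%C with w in H by ring.
    now apply H. }
  exists a, r. split; [exact Hr|]. split; [exact (pseries_summable a r _ Hs)|].
  intros z Hz. symmetry. apply psum_unique.
  specialize (Hs _ Hz). now replace (z0 + (z - z0))%C with z in Hs by ring.
Qed.

Lemma expands_cderiv (f : C -> C) (z0 : C) (a : nat -> C) (r : R) (z : C) :
  expands_at f z0 a r -> Cmod (z - z0) < r ->
  cderiv f z (psum (dcoef a) (z - z0)).
Proof.
  intros (Hr & Ha & Hf) Hz.
  apply (cderiv_ext (fun w => psum a (w + - z0)%C) f z _ (r - Cmod (z - z0)));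
    [lra | |].
  - intros w Hw. symmetry. apply Hf.
    replace (w - z0)%C with ((w - z) + (z - z0))%C by ring.
    eapply Rle_lt_trans; [apply Cmod_triangle | lra].
  - apply cderiv_comp_shift. now apply (psum_cderiv a r).
Qed.

Lemma expands_C_derive (f : C -> C) (z0 : C) (a : nat -> C) (r : R) :
  expands_at f z0 a r -> expands_at (C_derive f) z0 (dcoef a) r.
Proof.
  intros H. pose proof H as (Hr & Ha & _).
  split; [exact Hr|]. split; [now apply dcoef_summable|].
  intros z Hz. now apply cderiv_C_derive, (expands_cderiv f z0 a r).
Qed.

Lemma expands_jet2 (f : C -> C) (z0 : C) (a : nat -> C) (r : R) :
  expands_at f z0 a r -> has_jet2 f z0.
Proof.
  intros (Hr & Ha & Hf). apply (has_jet2_ext (fun w => psum a (w - z0)) f z0 r Hr).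
  - intros w Hw. symmetry. now apply Hf.
  - now apply (psum_jet2 a r).
Qed.


(** * The maximum principle and the Schwarz lemma *)

Lemma list_argmax (T : Type) (g : T -> R) (l : list T) :
  l <> nil -> exists t, In t l /\ forall s, In s l -> g s <= g t.
Proof.
  induction l as [|x l IH]; [congruence|]. intros _.
  destruct l as [|y l].
  - exists x. split; [now left|]. intros s [->|[]]. lra.
  - destruct IH as (t & Ht & Hmax); [discriminate|].
    destruct (Rle_dec (g t) (g x)) as [H|H].
    + exists x. split; [now left|].
      intros s [->|Hs]; [lra | specialize (Hmax s Hs); lra].
    + exists t. split; [now right|].
      intros s [->|Hs]; [lra | now apply Hmax].
Qed.

Lemma Cmod_lt_coordinates (z : C) (d : R) :
  Rabs (Re z) < d -> Rabs (Im z) < d -> Cmod z < 2 * d.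
Proof.
  intros Hx Hy. apply Rsqr_incrst_0; [|apply Cmod_ge_0|pose proof (Rabs_pos (Re z)); lra].
  rewrite !Rsqr_pow2, Cmod2_alt, <- (pow2_abs (Re z)), <- (pow2_abs (Im z)).
  pose proof (Rabs_pos (Re z)). pose proof (Rabs_pos (Im z)). nra.
Qed.

(** If no point were maximal, each point t of the disk would have a
    neighbourhood on which u stays below a single value u(q_t). Finitely many
    neighbourhoods cover the disk, and the q_t with the largest value would lie
    in one of them. Points t outside the disk, but in the surrounding square,
    get neighbourhoods missing the disk. *)
Lemma usc_attains_max (u : C -> R) (r : R) :
  0 <= r ->
  (forall z, Cmod z <= r -> forall e, 0 < e ->
     exists d, 0 < d /\ forall w, Cmod (w - z) < d -> u w < u z + e) ->
  exists z0, Cmod z0 <= r /\ forall z, Cmod z <= r -> u z <= u z0.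
Proof.
  intros Hr Husc. apply NNPP. intros Hno.
  assert (Hq : forall t : Compactness.Tn 2 R, exists qd : C * posreal,
    Cmod (fst qd) <= r /\
    forall w, Cmod w <= r -> Rabs (Re w - fst t) < snd qd ->
      Rabs (Im w - fst (snd t)) < snd qd -> u w < u (fst qd)).
  { intros (x & y & []). simpl fst. simpl snd.
    destruct (Rle_dec (Cmod (x, y)) r) as [Ht|Ht].
    - assert (H : exists q, Cmod q <= r /\ u (x, y) < u q).
      { apply NNPP. intros H. apply Hno. exists (x, y). split; [exact Ht|].
        intros z Hz. apply Rnot_lt_le. intros Hlt. apply H. now exists z. }
      destruct H as (q & Hq & Hlt).
      destruct (Husc _ Ht (u q - u (x, y))) as (d & Hd & H); [lra|].
      assert (Hd2 : 0 < d / 2) by lra.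
      exists (q, mkposreal _ Hd2). simpl fst. simpl snd. split; [exact Hq|].
      intros w _ Hx Hy. simpl pos in Hx, Hy.
      replace (u q) with (u (x, y) + (u q - u (x, y))) by ring. apply H.
      replace d with (2 * (d / 2)) by field.
      now apply Cmod_lt_coordinates.
    - assert (Hd : 0 < (Cmod (x, y) - r) / 2) by lra.
      exists (RtoC 0, mkposreal _ Hd). simpl fst. simpl snd.
      split; [now rewrite Cmod_0|].
      intros w Hw Hx Hy. exfalso. simpl pos in Hx, Hy.
      pose proof (Cmod_lt_coordinates (w - (x, y)) _ Hx Hy) as Hlt.
      pose proof (Cmod_triangle w (- (w - (x, y)))) as H. rewrite Cmod_opp in H.
      assert (E : forall a b : C, (a + - (a - b))%C = b) by (intros; ring).
      rewrite E in H. lra. }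
  set (qd := fun t => proj1_sig (constructive_indefinite_description _ (Hq t))).
  assert (Hqd : forall t, Cmod (fst (qd t)) <= r /\
    forall w, Cmod w <= r -> Rabs (Re w - fst t) < snd (qd t) ->
      Rabs (Im w - fst (snd t)) < snd (qd t) -> u w < u (fst (qd t)))
    by (intros t; apply (proj2_sig (constructive_indefinite_description _ (Hq t)))).
  clearbody qd.
  apply (compactness_list 2 (- r, (- r, tt)) (r, (r, tt)) (fun t => snd (qd t))).
  intros (l & Hl).
  assert (Hcover : forall z, Cmod z <= r -> exists t, In t l /\ u z < u (fst (qd t))).
  { intros z Hz.
    assert (Hb : forall x, Rabs x <= Cmod z -> - r <= x <= r)
      by (intros x Hx; apply Rabs_le_between; lra).
    destruct (Hl (Re z, (Im z, tt))) as (t & Ht & _ & Hclose).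
    - simpl. split; [apply Hb, re_le_Cmod|]. split; [|exact I]. apply Hb.
      eapply Rle_trans; [|apply Rmax_Cmod]. apply Rmax_r.
    - exists t. split; [exact Ht|]. destruct t as (x & y & []).
      destruct Hclose as (Hx & Hy & _).
      now apply (proj2 (Hqd (x, (y, tt)))). }
  assert (Hnil : l <> nil).
  { intros ->. destruct (Hcover 0) as (t & [] & _). now rewrite Cmod_0. }
  destruct (list_argmax _ (fun t => u (fst (qd t))) l Hnil) as (t & Ht & Hmax).
  destruct (Hcover (fst (qd t)) (proj1 (Hqd t))) as (s & Hs & Hlt).
  specialize (Hmax s Hs). simpl in Hmax. lra.
Qed.

Lemma Cmod_sq_plus (a b : C) :
  Cmod (a + b) ^ 2 = Cmod a ^ 2 + 2 * Re (Cconj a * b) + Cmod b ^ 2.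
Proof. rewrite !Cmod2_alt. destruct a, b. simpl. ring. Qed.

Lemma Re_conj_mult_le (a b : C) : Rabs (Re (Cconj a * b)) <= Cmod a * Cmod b.
Proof.
  eapply Rle_trans; [apply re_le_Cmod|]. rewrite Cmod_mult, Cmod_conj. lra.
Qed.

(** Averaged over the four points z + t i^k, the linear and quadratic terms of
    the jet cancel, so the mean of |F|^2 + eps |w|^2 exceeds its value at z by
    at least eps t^2 - O(t^3). *)
Lemma subharmonic_no_local_max (F : C -> C) (z : C) (eps d : R) :
  has_jet2 F z -> 0 < eps -> 0 < d ->
  exists w, Cmod (w - z) < d /\
    Cmod (F z) ^ 2 + eps * Cmod z ^ 2 < Cmod (F w) ^ 2 + eps * Cmod w ^ 2.
Proof.
  intros (c0 & c1 & c2 & HF) Heps Hd. rewrite (jet2_value F z c0 c1 c2 HF).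
  destruct HF as (K & d' & HK & Hd' & HF).
  set (B := 2 * Cmod c0 * K + 1).
  assert (HB : 0 < B) by (pose proof (Cmod_ge_0 c0); unfold B; nra).
  set (t := Rmin (Rmin d d') (eps / B) / 2).
  assert (Ht : 0 < t /\ t < d /\ t < d' /\ t * B < eps).
  { assert (H1 : 0 < Rmin (Rmin d d') (eps / B)).
    { repeat apply Rmin_glb_lt; try assumption. now apply Rdiv_lt_0_compat. }
    pose proof (Rmin_l (Rmin d d') (eps / B)).
    pose proof (Rmin_r (Rmin d d') (eps / B)) as H2.
    pose proof (Rmin_l d d'). pose proof (Rmin_r d d').
    unfold t. repeat split; try lra.
    apply Rmult_le_compat_r with (r := B) in H2; [|lra].
    replace (eps / B * B) with eps in H2 by (field; lra). nra. }
  destruct Ht as (Ht0 & Htd & Htd' & Hteps).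
  apply NNPP. intros Hno.
  assert (Hpt : forall h, Cmod h = t ->
    2 * Re (Cconj c0 * (c1 * h + c2 * (h * h))) + 2 * eps * Re (Cconj z * h)
      + eps * t ^ 2 <= 2 * Cmod c0 * K * t ^ 3).
  { intros h Hh.
    assert (Hle : Cmod (F (z + h)%C) ^ 2 + eps * Cmod (z + h) ^ 2
                    <= Cmod c0 ^ 2 + eps * Cmod z ^ 2).
    { apply Rnot_lt_le. intros Hlt. apply Hno. exists (z + h)%C.
      split; [|exact Hlt]. replace (z + h - z)%C with h by ring. lra. }
    specialize (HF h ltac:(lra)). rewrite Hh in HF.
    replace (c0 + c1 * h + c2 * (h * h))%C with (c0 + (c1 * h + c2 * (h * h)))%C
      in HF by ring.
    set (P := (c1 * h + c2 * (h * h))%C) in *.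
    set (e := (F (z + h) - (c0 + P))%C) in HF.
    replace (F (z + h)%C) with (c0 + (P + e))%C in Hle
      by (unfold e; ring).
    rewrite (Cmod_sq_plus c0), (Cmod_sq_plus z), Hh,
      (Cmult_plus_distr_l (Cconj c0)), re_plus in Hle.
    pose proof (pow2_ge_0 (Cmod (P + e))) as Hsq.
    pose proof (Re_conj_mult_le c0 e) as He. apply Rabs_le_between in He.
    assert (Hce : Cmod c0 * Cmod e <= Cmod c0 * (K * t ^ 3))
      by (apply Rmult_le_compat_l; [apply Cmod_ge_0 | exact HF]).
    lra. }
  assert (Hm : forall a b : R, a ^ 2 + b ^ 2 = t ^ 2 -> Cmod (a, b) = t).
  { intros a b H. unfold Cmod. simpl fst. simpl snd. rewrite H. apply sqrt_pow2. lra. }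
  pose proof (Hpt (t, 0) (Hm t 0 ltac:(ring))) as P1.
  pose proof (Hpt (0, t) (Hm 0 t ltac:(ring))) as P2.
  pose proof (Hpt (- t, 0) (Hm (- t) 0 ltac:(ring))) as P3.
  pose proof (Hpt (0, - t) (Hm 0 (- t) ltac:(ring))) as P4.
  assert (Hsum : 4 * (eps * t ^ 2) <= 4 * (2 * Cmod c0 * K * t ^ 3)).
  { clear - P1 P2 P3 P4. destruct c0 as [a0 b0]. destruct c1 as [a1 b1].
    destruct c2 as [a2 b2]. destruct z as [x y].
    set (M := 2 * Cmod (a0, b0) * K * t ^ 3) in *. simpl in P1, P2, P3, P4. simpl. lra. }
  assert (Hlt : 2 * Cmod c0 * K * t ^ 3 < eps * t ^ 2).
  { replace (2 * Cmod c0 * K * t ^ 3) with ((t * (2 * Cmod c0 * K)) * t ^ 2) by ring.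
    apply Rmult_lt_compat_r; [apply pow_lt, Ht0|]. unfold B in Hteps. lra. }
  lra.
Qed.

Lemma jet2_usc (F : C -> C) (z : C) (eps e : R) :
  has_jet2 F z -> 0 < eps -> 0 < e ->
  exists d, 0 < d /\ forall w, Cmod (w - z) < d ->
    Cmod (F w) ^ 2 + eps * Cmod w ^ 2 < Cmod (F z) ^ 2 + eps * Cmod z ^ 2 + e.
Proof.
  intros (c0 & c1 & c2 & HF) Heps He. rewrite (jet2_value F z c0 c1 c2 HF).
  destruct (jet2_continuous F z c0 c1 c2 HF) as (K & d & HK & Hd & H).
  set (B := 2 * Cmod c0 * K + K * K + eps * (2 * Cmod z + 1) + 1).
  pose proof (Cmod_ge_0 c0) as Hc0. pose proof (Cmod_ge_0 z) as Hz0.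
  assert (HB : 0 < B) by (unfold B; nra).
  exists (Rmin (Rmin d 1) (e / B)).
  split; [repeat apply Rmin_glb_lt; try lra; now apply Rdiv_lt_0_compat|].
  intros w Hw. set (h := (w - z)%C) in Hw.
  assert (Hh : Cmod h < d /\ Cmod h < 1 /\ Cmod h * B < e).
  { pose proof (Rmin_l (Rmin d 1) (e / B)).
    pose proof (Rmin_r (Rmin d 1) (e / B)) as H2.
    pose proof (Rmin_l d 1). pose proof (Rmin_r d 1).
    repeat split; try lra.
    apply Rlt_le_trans with (e / B * B); [apply Rmult_lt_compat_r; lra|].
    right. field. lra. }
  destruct Hh as (Hhd & Hh1 & HhB). apply H in Hhd. rewrite pow_1 in Hhd.
  replace w with (z + h)%C by (unfold h; ring).
  set (v := (F (z + h) - c0)%C) in Hhd.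
  replace (F (z + h)%C) with (c0 + v)%C by (unfold v; ring).
  rewrite !Cmod_sq_plus.
  pose proof (Re_conj_mult_le c0 v) as H1. apply Rabs_le_between in H1.
  pose proof (Re_conj_mult_le z h) as H2. apply Rabs_le_between in H2.
  pose proof (Cmod_ge_0 h) as Hh0. pose proof (Cmod_ge_0 v) as Hv0.
  assert (H3 : Cmod c0 * Cmod v <= Cmod c0 * (K * Cmod h))
    by (apply Rmult_le_compat_l; assumption).
  assert (H4 : Cmod v ^ 2 <= K * K * Cmod h).
  { apply Rle_trans with ((K * Cmod h) * (K * Cmod h)).
    - simpl. rewrite Rmult_1_r. now apply Rmult_le_compat.
    - replace (K * Cmod h * (K * Cmod h)) with (K * K * (Cmod h * Cmod h)) by ring.
      apply Rmult_le_compat_l; [now apply Rmult_le_pos | nra]. }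
  assert (H5 : eps * (2 * Re (Cconj z * h) + Cmod h ^ 2)
               <= eps * ((2 * Cmod z + 1) * Cmod h)).
  { apply Rmult_le_compat_l; [lra|]. nra. }
  unfold B in HhB. nra.
Qed.

(** The maximum of |F|^2 + eps |w|^2 over the disk can only be on the circle,
    where that function is at most B^2 + eps r^2; then eps tends to 0. *)
Lemma maximum_modulus (F : C -> C) (r B : R) :
  0 <= r -> (forall z, Cmod z <= r -> has_jet2 F z) ->
  (forall z, Cmod z = r -> Cmod (F z) <= B) ->
  forall z, Cmod z <= r -> Cmod (F z) <= B.
Proof.
  intros Hr HF HB z Hz.
  assert (Heps : forall eps, 0 < eps ->
            0 <= B /\ Cmod (F z) ^ 2 <= B ^ 2 + eps * r ^ 2).
  { intros eps Heps.
    destruct (usc_attains_max (fun w => Cmod (F w) ^ 2 + eps * Cmod w ^ 2) r Hr)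
      as (z0 & Hz0 & Hmax).
    { intros w Hw e He. exact (jet2_usc F w eps e (HF w Hw) Heps He). }
    destruct (Rlt_le_dec (Cmod z0) r) as [Hlt|Hge].
    - destruct (subharmonic_no_local_max F z0 eps (r - Cmod z0) (HF z0 Hz0) Heps)
        as (w & Hw & Hgt); [lra|].
      exfalso. specialize (Hmax w). cbv beta in Hmax.
      pose proof (Cmod_triangle (w - z0) z0) as Ht.
      replace (w - z0 + z0)%C with w in Ht by ring. specialize (Hmax ltac:(lra)). lra.
    - assert (E : Cmod z0 = r) by lra. specialize (HB z0 E).
      specialize (Hmax z Hz). cbv beta in Hmax. rewrite E in Hmax.
      pose proof (Cmod_ge_0 (F z0)). split; [lra|].
      assert (Cmod (F z0) ^ 2 <= B ^ 2) by (apply pow_incr; lra).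
      pose proof (Rmult_le_pos eps (Cmod z ^ 2) ltac:(lra) (pow2_ge_0 _)). lra. }
  destruct (Heps 1 Rlt_0_1) as [HB0 _].
  apply Rsqr_incr_0; [|apply Cmod_ge_0 | exact HB0]. rewrite !Rsqr_pow2.
  apply le_epsilon. intros e He.
  destruct (Heps (e / (r ^ 2 + 1))) as [_ H].
  { apply Rdiv_lt_0_compat; [exact He|]. pose proof (pow2_ge_0 r). lra. }
  eapply Rle_trans; [exact H|]. apply Rplus_le_compat_l.
  pose proof (pow2_ge_0 r).
  apply Rmult_le_reg_r with (r ^ 2 + 1); [lra|].
  replace (e / (r ^ 2 + 1) * r ^ 2 * (r ^ 2 + 1)) with (e * r ^ 2) by (field; lra).
  nra.
Qed.

Lemma schwarz (F : C -> C) :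
  (forall z, in_disk z -> has_jet2 F z) ->
  (forall z, in_disk z -> Cmod (z * F z) <= 1) ->
  forall z, in_disk z -> Cmod (F z) <= 1.
Proof.
  intros HF Hb z Hz. unfold in_disk in *.
  pose proof (Cmod_ge_0 z) as Hz0. pose proof (Cmod_ge_0 (F z)) as HF0.
  assert (H : forall r, Cmod z < r < 1 -> r * Cmod (F z) <= 1).
  { intros r Hr. apply Rmult_le_reg_l with (/ r); [apply Rinv_0_lt_compat; lra|].
    rewrite <- Rmult_assoc, Rinv_l, Rmult_1_l, Rmult_1_r by lra.
    apply (maximum_modulus F r (/ r)); try lra.
    - intros w Hw. apply HF. lra.
    - intros w Hw. specialize (Hb w ltac:(lra)). rewrite Cmod_mult, Hw in Hb.
      apply Rmult_le_reg_l with r; [lra|]. rewrite Rinv_r; lra. }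
  apply Rnot_lt_le. intros Hgt.
  set (r := Rmax ((Cmod z + 1) / 2) ((/ Cmod (F z) + 1) / 2)).
  assert (Hinv : / Cmod (F z) < 1) by (rewrite <- Rinv_1; apply Rinv_lt_contravar; lra).
  pose proof (Rmax_l ((Cmod z + 1) / 2) ((/ Cmod (F z) + 1) / 2)) as H1.
  pose proof (Rmax_r ((Cmod z + 1) / 2) ((/ Cmod (F z) + 1) / 2)) as H2.
  assert (H3 : r < 1) by (apply Rmax_lub_lt; lra).
  specialize (H r ltac:(unfold r in *; lra)). fold r in H2.
  assert (H4 : / Cmod (F z) < r) by lra.
  apply Rmult_lt_compat_r with (r := Cmod (F z)) in H4; [|lra].
  rewrite Rinv_l in H4 by lra. lra.
Qed.


(** * The pole function on the Robertson class *)

(** The value of z f''/f' for the extremal functions is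
    [rob_coef alpha] * w / (1 - w) with |w| = |z|. *)
Definition rob_coef (alpha : R) : C :=
  (1 + Cconj (Cexpi alpha) * Cconj (Cexpi alpha))%C.

Lemma Cexpi_conj_mult (alpha : R) : (Cexpi alpha * Cconj (Cexpi alpha) = 1)%C.
Proof.
  apply injective_projections; simpl; [|ring].
  rewrite Ropp_mult_distr_r_reverse. unfold Rminus. rewrite Ropp_involutive.
  pose proof (sin2_cos2 alpha) as H. unfold Rsqr in H. lra.
Qed.

Lemma Cmod_Cexpi (t : R) : Cmod (Cexpi t) = 1.
Proof.
  unfold Cmod, Cexpi. simpl fst. simpl snd.
  rewrite <- !Rsqr_pow2, Rplus_comm, sin2_cos2. apply sqrt_1.
Qed.

Lemma Cexpi_double (alpha : R) : Cexpi (2 * alpha) = (Cexpi alpha * Cexpi alpha)%C.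
Proof.
  unfold Cexpi. rewrite cos_2a, sin_2a.
  apply injective_projections; simpl; ring.
Qed.

Lemma Cexpi_mult_rob_coef (alpha : R) :
  (Cexpi alpha * rob_coef alpha = Cexpi alpha + Cconj (Cexpi alpha))%C.
Proof.
  unfold rob_coef.
  replace (Cexpi alpha * (1 + Cconj (Cexpi alpha) * Cconj (Cexpi alpha)))%C
    with (Cexpi alpha + (Cexpi alpha * Cconj (Cexpi alpha)) * Cconj (Cexpi alpha))%C
    by ring.
  rewrite Cexpi_conj_mult. ring.
Qed.

Lemma Cmod_1_plus_Cexpi (alpha : R) :
  Cmod (1 + Cexpi (2 * alpha)) = Cmod (rob_coef alpha).
Proof.
  rewrite <- (Cmod_conj (rob_coef alpha)). unfold rob_coef.
  rewrite Cexpi_double, Cplus_conj, Cmult_conj, Cconj_conj.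
  do 2 f_equal. apply injective_projections; simpl; ring.
Qed.

Lemma Cmod_1_minus_Cexpi (alpha : R) :
  Cmod (1 - Cexpi (2 * alpha)) = Cmod (2 - rob_coef alpha).
Proof.
  rewrite <- (Cmod_conj (2 - rob_coef alpha)). unfold rob_coef.
  rewrite Cexpi_double, Cminus_conj, Cplus_conj, Cmult_conj, Cconj_conj.
  f_equal. apply injective_projections; simpl; ring.
Qed.

Lemma rob_coef_neq_0 (alpha : R) : 0 < cos alpha -> rob_coef alpha <> 0.
Proof.
  intros Hc E. pose proof (Cexpi_mult_rob_coef alpha) as H.
  rewrite E, Cmult_0_r in H. apply (f_equal Re) in H. simpl in H. lra.
Qed.

Lemma cos_pos_of_Rabs (alpha : R) : Rabs alpha < PI / 2 -> 0 < cos alpha.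
Proof. intros H. apply Rabs_lt_between in H. apply cos_gt_0; lra. Qed.

(** The map p |-> (p - s) / (p + conj s), for Re s > 0, carries the right half
    plane onto the unit disk. *)
Lemma Cmod_half_plane_disk (p s : C) :
  Cmod (p - s) ^ 2 = Cmod (p + Cconj s) ^ 2 - 4 * (Re p * Re s).
Proof. rewrite !Cmod2_alt. destruct p, s. simpl. ring. Qed.

(** With p = e^(i alpha) (1 + z f''/f'), this is
    (p - e^(i alpha)) / (z (p + e^(-i alpha))), simplified so that the division
    by z disappears and analyticity at 0 is visible. *)
Definition schwarz_quotient (alpha : R) (f : C -> C) (z : C) : C :=
  (C_derive (C_derive f) z *
   / (rob_coef alpha * C_derive f z + z * C_derive (C_derive f) z))%C.

Lemma schwarz_quotient_self_map (alpha : R) (f : C -> C) (z : C) :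
  0 < cos alpha -> Robertson alpha f -> in_disk z ->
  (rob_coef alpha * C_derive f z + z * C_derive (C_derive f) z <> 0)%C /\
  Cmod (z * schwarz_quotient alpha f z) <= 1.
Proof.
  intros Hc (_ & Hne & _ & _ & Hre) Hz.
  specialize (Hne z Hz). specialize (Hre z Hz). unfold schwarz_quotient.
  set (d1 := C_derive f z) in *. set (d2 := C_derive (C_derive f) z) in *.
  set (s := Cexpi alpha) in *. set (p := (s * (1 + z * (d2 / d1)))%C) in Hre.
  set (D := (rob_coef alpha * d1 + z * d2)%C).
  assert (Hs : Re s = cos alpha) by reflexivity.
  assert (HD : (s * D = d1 * (p + Cconj s))%C).
  { unfold D. rewrite Cmult_plus_distr_l, Cmult_assoc.
    unfold s at 1. rewrite Cexpi_mult_rob_coef. fold s. unfold p. field. exact Hne. }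
  assert (Hps : (p + Cconj s)%C <> 0).
  { intros E. apply (f_equal Re) in E. rewrite re_plus, re_conj, Hs, re_RtoC in E. lra. }

  assert (HD0 : D <> 0).
  { intros E. rewrite E, Cmult_0_r in HD.
    exact (Cmult_neq_0 _ _ Hne Hps (eq_sym HD)). }
  assert (Hs0 : s <> 0).
  { intros E. apply (f_equal Re) in E. rewrite Hs, re_RtoC in E. lra. }
  split; [exact HD0|].
  replace (z * (d2 * / D))%C with ((p - s) / (p + Cconj s))%C.
  - rewrite Cmod_div by exact Hps.
    apply Rmult_le_reg_r with (Cmod (p + Cconj s)); [now apply Cmod_gt_0|].
    unfold Rdiv. rewrite Rmult_assoc, Rinv_l, Rmult_1_l, Rmult_1_r
      by (apply Rgt_not_eq, Cmod_gt_0, Hps).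
    apply Rsqr_incr_0; try apply Cmod_ge_0. rewrite !Rsqr_pow2.
    rewrite Cmod_half_plane_disk, Hs. nra.
  - replace D with (d1 * (p + Cconj s) / s)%C by (rewrite <- HD; now field).
    replace (p - s)%C with (s * z * (d2 / d1))%C by (unfold p; ring).
    field. repeat split; assumption.
Qed.

Lemma schwarz_quotient_jet2 (alpha : R) (f : C -> C) (z : C) :
  0 < cos alpha -> Robertson alpha f -> in_disk z ->
  has_jet2 (schwarz_quotient alpha f) z.
Proof.
  intros Hc Hf Hz.
  destruct (analytic_expands f z (proj1 Hf) Hz) as (a & r & Ha).
  apply expands_C_derive in Ha. pose proof (expands_C_derive _ _ _ _ Ha) as Ha'.
  apply expands_jet2 in Ha. apply expands_jet2 in Ha'.
  unfold schwarz_quotient. apply has_jet2_mult; [exact Ha'|].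
  apply (has_jet2_inv
    (fun w => rob_coef alpha * C_derive f w + w * C_derive (C_derive f) w)%C).
  - apply has_jet2_plus; apply has_jet2_mult; try assumption.
    + apply has_jet2_const.
    + apply has_jet2_id.
  - exact (proj1 (schwarz_quotient_self_map alpha f z Hc Hf Hz)).
Qed.

Lemma schwarz_quotient_le_1 (alpha : R) (f : C -> C) (z : C) :
  0 < cos alpha -> Robertson alpha f -> in_disk z ->
  Cmod (schwarz_quotient alpha f z) <= 1.
Proof.
  intros Hc Hf. apply schwarz.
  - intros w Hw. now apply schwarz_quotient_jet2.
  - intros w Hw. now apply schwarz_quotient_self_map.
Qed.

(** Writing phi for [schwarz_quotient alpha f z] and A for [rob_coef alpha],
    the pole P satisfies A P = 2/phi - z (2 - A); now use |phi| <= 1. *)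
Lemma pole_bound_le (alpha : R) (f : C -> C) (z : C) :
  0 < cos alpha -> Robertson alpha f -> in_disk z ->
  Rbar_le (pole_bound alpha z) (Cinf_mod (pole f z)).
Proof.
  intros Hc Hf Hz. unfold pole.
  destruct (Ceq_dec (C_derive (C_derive f) z) 0) as [E|Hd2]; [exact I|].
  simpl. unfold pole_bound. rewrite Cmod_1_plus_Cexpi, Cmod_1_minus_Cexpi.
  pose proof (schwarz_quotient_le_1 alpha f z Hc Hf Hz) as Hphi.
  pose proof (proj1 (schwarz_quotient_self_map alpha f z Hc Hf Hz)) as HD.
  unfold schwarz_quotient in Hphi.
  pose proof (rob_coef_neq_0 alpha Hc) as HA.
  set (A := rob_coef alpha) in *.
  set (d1 := C_derive f z) in *. set (d2 := C_derive (C_derive f) z) in *.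
  set (phi := (d2 * / (A * d1 + z * d2))%C) in *.
  assert (Hphi0 : phi <> 0).
  { intros E. apply Hd2. replace d2 with (phi * (A * d1 + z * d2))%C
      by (unfold phi; now field). rewrite E. ring. }
  assert (HP : (z + 2 * (d1 / d2) = (2 / phi - z * (2 - A)) / A)%C).
  { unfold phi. field. repeat split; assumption. }
  rewrite HP, Cmod_div by exact HA.
  unfold Rdiv. apply Rmult_le_compat_r.
  { apply Rlt_le, Rinv_0_lt_compat, Cmod_gt_0, HA. }
  assert (H1 : 2 <= Cmod (2 / phi)).
  { rewrite Cmod_div by exact Hphi0. rewrite Cmod_R, Rabs_pos_eq by lra.
    pose proof (proj1 (Cmod_gt_0 phi) Hphi0) as Hpos.
    apply Rmult_le_reg_r with (Cmod phi); [exact Hpos|].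
    unfold Rdiv. rewrite Rmult_assoc, Rinv_l; lra. }
  pose proof (Cmod_triangle (2 / phi - z * (2 - A)) (z * (2 - A))) as H2.
  replace (2 / phi - z * (2 - A) + z * (2 - A))%C with (2 / phi)%C in H2 by ring.
  rewrite Cmod_mult in H2. lra.
Qed.


(** * The binomial series *)

(** Taylor coefficients of (1 - w)^(-B). *)
Fixpoint binc (B : C) (n : nat) : C :=
  match n with
  | O => 1
  | S m => (binc B m * ((B + INR m) / INR (S m)))%C
  end.

Lemma binc_S (B : C) (n : nat) :
  binc B (S n) = (binc B n * ((B + INR n) / INR (S n)))%C.
Proof. reflexivity. Qed.

Lemma INR_S_neq_0 (n : nat) : RtoC (INR (S n)) <> 0.
Proof. intros E. apply RtoC_inj in E. now apply not_0_INR in E. Qed.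

Lemma binc_summable (B : C) : summable_within (binc B) 1.
Proof.
  set (M := Cmod B + 1).
  pose proof (Cmod_ge_0 B) as HB.
  set (beta := fix beta (n : nat) : R :=
    match n with O => 1 | S m => beta m * ((M + INR m) / INR (S m)) end).
  assert (HbS : forall n, beta (S n) = beta n * ((M + INR n) / INR (S n)))
    by reflexivity.
  assert (Hpos : forall n, 0 < beta n).
  { induction n as [|n IH]; [simpl; lra|]. rewrite HbS.
    apply Rmult_lt_0_compat; [exact IH|]. apply Rdiv_lt_0_compat.
    - pose proof (pos_INR n). unfold M. lra.
    - apply lt_0_INR. lia. }
  assert (Hle : forall n, Cmod (binc B n) <= beta n).
  { induction n as [|n IH]; [simpl; rewrite Cmod_1; lra|].
    rewrite HbS, binc_S.
    rewrite Cmod_mult. apply Rmult_le_compat; try apply Cmod_ge_0; [exact IH|].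
    pose proof (lt_0_INR (S n) ltac:(lia)) as Hn.
    rewrite Cmod_div by apply INR_S_neq_0.
    rewrite (Cmod_R (INR (S n))), (Rabs_pos_eq (INR (S n))) by lra.
    unfold Rdiv. apply Rmult_le_compat_r; [apply Rlt_le, Rinv_0_lt_compat, Hn|].
    eapply Rle_trans; [apply Cmod_triangle|].
    rewrite Cmod_R, Rabs_pos_eq by apply pos_INR. unfold M. lra. }
  assert (Hrad : CV_radius beta = 1).
  { rewrite <- Rinv_1. apply CV_radius_finite_DAlembert; [|lra|].
    - intros n. apply Rgt_not_eq, Hpos.
    - apply (is_lim_seq_ext (fun n => 1 + (M - 1) * / INR (S n))).
      + intros n. pose proof (Hpos n) as Hn. rewrite HbS.
        pose proof (lt_0_INR (S n) ltac:(lia)) as HSn.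
        pose proof (pos_INR n) as Hn0.
        rewrite Rabs_pos_eq.
        * rewrite S_INR in *. field. lra.
        * apply Rlt_le, Rdiv_lt_0_compat; [|exact Hn].
          apply Rmult_lt_0_compat; [exact Hn|]. apply Rdiv_lt_0_compat; [|exact HSn].
          unfold M. lra.
      + replace (Finite 1) with (Finite (1 + (M - 1) * 0)) by (f_equal; ring).
        apply is_lim_seq_plus'; [apply is_lim_seq_const|].
        apply (is_lim_seq_scal_l (fun n => / INR (S n)) (M - 1) 0).
        apply (is_lim_seq_incr_1 (fun n => / INR n)).
        replace (Finite 0) with (Rbar_inv p_infty) by reflexivity.
        apply is_lim_seq_inv; [apply is_lim_seq_INR | discriminate]. }
  intros rho Hrho.
  apply (ex_series_le (K := R_AbsRing) (V := R_CompleteNormedModule) _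
           (fun n => Rabs (beta n * rho ^ n))).
  - intros n. change (Rabs (Cmod (binc B n) * rho ^ n) <= Rabs (beta n * rho ^ n)).
    pose proof (pow_le rho n (proj1 Hrho)) as Hp.
    rewrite !Rabs_mult. apply Rmult_le_compat_r; [apply Rabs_pos|].
    rewrite !Rabs_pos_eq; [apply Hle | apply Rlt_le, Hpos | apply Cmod_ge_0].
  - apply CV_disk_inside. rewrite Hrad, Rabs_pos_eq by lra. exact (proj2 Hrho).
Qed.

Definition binpow (B w : C) : C := psum (binc B) w.

Lemma one_minus_neq_0 (w : C) : Cmod w < 1 -> (1 - w)%C <> 0.
Proof.
  intros Hw E. replace w with (1 - (1 - w))%C in Hw by ring. rewrite E in Hw.
  replace (1 - 0)%C with (RtoC 1) in Hw by ring. rewrite Cmod_1 in Hw. lra.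
Qed.

(** The recursion (n+1) b_(n+1) = (B+n) b_n says g' = B g + w g'. *)
Lemma binpow_cderiv (B w : C) :
  Cmod w < 1 -> cderiv (binpow B) w (B * binpow B w / (1 - w))%C.
Proof.
  intros Hw. pose proof (binc_summable B) as Hs.
  replace (B * binpow B w / (1 - w))%C with (psum (dcoef (binc B)) w).
  { exact (psum_cderiv (binc B) 1 w Hs Hw). }
  pose proof (one_minus_neq_0 w Hw) as H1.
  pose proof (psum_correct _ 1 w Hs Hw) as S0.
  pose proof (psum_correct _ 1 w (dcoef_summable _ _ Hs) Hw) as S1.
  assert (S2 : Cseries (fun n => INR n * (binc B n * w ^ n))%C
                 (w * psum (dcoef (binc B)) w)%C).
  { replace (w * psum (dcoef (binc B)) w)%C
      with (INR 0 * (binc B 0 * w ^ 0) + w * psum (dcoef (binc B)) w)%C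
      by (simpl; ring).
    apply (Cseries_cons (fun n => INR n * (binc B n * w ^ n))%C).
    eapply Cseries_ext; [|exact (Cseries_scal w _ _ S1)].
    intros n. cbv beta. unfold dcoef. rewrite (Cpow_S w n). ring. }
  assert (E : (psum (dcoef (binc B)) w = B * binpow B w + w * psum (dcoef (binc B)) w)%C).
  { apply psum_unique.
    eapply Cseries_ext; [|exact (Cseries_plus _ _ _ _ (Cseries_scal B _ _ S0) S2)].
    intros n. cbv beta. unfold dcoef. rewrite binc_S.
    pose proof (INR_S_neq_0 n). field. assumption. }
  set (g' := psum (dcoef (binc B)) w) in *.
  replace (B * binpow B w)%C with (g' * (1 - w))%C.
  - field. exact H1.
  - replace (g' * (1 - w))%C with (g' - w * g')%C by ring. rewrite E at 1. ring.
Qed.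

Lemma binpow_0 (B : C) : binpow B 0 = 1.
Proof. apply psum_0. Qed.

Lemma binpow_opp (B w : C) : Cmod w < 1 -> (binpow B w * binpow (- B) w = 1)%C.
Proof.
  intros Hw.
  rewrite (cderiv_null_constant (fun w => binpow B w * binpow (- B) w)%C 1 w);
    [rewrite !binpow_0; ring | | exact Hw].
  intros z Hz.
  pose proof (one_minus_neq_0 z Hz) as H1.
  pose proof (cderiv_mult _ _ _ _ _ (binpow_cderiv B z Hz) (binpow_cderiv (- B) z Hz))
    as H.
  eapply eq_ind; [exact H|]. field. exact H1.
Qed.

Lemma binpow_neq_0 (B w : C) : Cmod w < 1 -> binpow B w <> 0.
Proof.
  intros Hw E. pose proof (binpow_opp B w Hw) as H. rewrite E, Cmult_0_l in H.
  apply RtoC_inj in H. lra.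
Qed.

(** The identity 1 - (w0 + d) = (1 - w0) (1 - d / (1 - w0)), raised to the power
    -B; it shows that [binpow B] has a power series around every point. *)
Lemma binpow_recenter (B w0 d : C) :
  Cmod w0 < 1 -> Cmod d < 1 - Cmod w0 ->
  binpow B (w0 + d) = (binpow B w0 * binpow B (/ (1 - w0) * d))%C.
Proof.
  intros Hw0 Hd. set (k := (/ (1 - w0))%C).
  pose proof (one_minus_neq_0 w0 Hw0) as H1.
  assert (Hk : forall h, Cmod h < 1 - Cmod w0 -> Cmod (k * h) < 1).
  { intros h Hh. unfold k. rewrite Cmod_mult, Cmod_inv by exact H1.
    pose proof (proj1 (Cmod_gt_0 _) H1) as Hpos.
    apply Rmult_lt_reg_l with (Cmod (1 - w0)); [exact Hpos|].
    rewrite <- Rmult_assoc, Rinv_r, Rmult_1_l, Rmult_1_r by lra.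
    pose proof (Cmod_triangle (1 - w0) w0) as Ht.
    replace (1 - w0 + w0)%C with (RtoC 1) in Ht by ring. rewrite Cmod_1 in Ht. lra. }
  assert (Hsum : forall h, Cmod h < 1 - Cmod w0 -> Cmod (h + w0) < 1)
    by (intros h Hh; pose proof (Cmod_triangle h w0); lra).
  assert (Hconst := cderiv_null_constant
    (fun h => binpow B (h + w0) * binpow (- B) (k * h))%C (1 - Cmod w0) d).
  cbv beta in Hconst. rewrite Cmult_0_r, Cplus_0_l, binpow_0, Cmult_1_r in Hconst.
  rewrite <- Hconst; [| |exact Hd].
  - rewrite (Cplus_comm d w0), <- Cmult_assoc.
    rewrite (Cmult_comm (binpow (- B) (k * d))), binpow_opp by now apply Hk.
    ring.
  - intros z Hz. specialize (Hk z Hz). specialize (Hsum z Hz).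
    pose proof (cderiv_mult _ _ _ _ _
       (cderiv_comp_shift _ z _ w0 (binpow_cderiv B _ Hsum))
       (cderiv_comp_scal _ z _ k (binpow_cderiv (- B) _ Hk))) as H.
    cbv beta in H. eapply eq_ind; [exact H|].
    apply one_minus_neq_0 in Hsum. apply one_minus_neq_0 in Hk.
    assert (E : (1 - k * z = k * (1 - (z + w0)))%C)
      by (unfold k; field; exact H1).
    rewrite E in *.
    assert (Hk0 : k <> 0).
    { intros E0. apply Hk. rewrite E0. ring. }
    field. split; assumption.
Qed.

(** * The extremal functions *)

(** The primitive of (1 - c z)^(-A) vanishing at 0, for A = [rob_coef alpha];
    since A - 1 = e^(-2 i alpha) is never 0, no logarithm occurs. *)
Definition extremal (alpha : R) (c z : C) : C :=
  let B := (rob_coef alpha - 1)%C in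
  (/ (c * B) * binpow B (c * z) + - / (c * B))%C.

Lemma rob_coef_minus_1_neq_0 (alpha : R) : (rob_coef alpha - 1)%C <> 0.
Proof.
  unfold rob_coef. set (t := Cconj (Cexpi alpha)).
  replace (1 + t * t - 1)%C with (t * t)%C by ring.
  assert (Ht : t <> 0).
  { intros E. pose proof (Cexpi_conj_mult alpha) as H. fold t in H.
    rewrite E, Cmult_0_r in H. apply RtoC_inj in H. lra. }
  now apply Cmult_neq_0.
Qed.

Lemma extremal_C_derive (alpha : R) (c z : C) :
  Cmod c = 1 -> in_disk z ->
  C_derive (extremal alpha c) z
    = (binpow (rob_coef alpha - 1) (c * z) * / (1 - c * z))%C.
Proof.
  intros Hc Hz. apply cderiv_C_derive.
  assert (Hw : Cmod (c * z) < 1)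
    by (rewrite Cmod_mult, Hc; unfold in_disk in Hz; lra).
  pose proof (cderiv_affine _ _ _ (/ (c * (rob_coef alpha - 1)))
                (- / (c * (rob_coef alpha - 1)))
     (cderiv_comp_scal _ z _ c (binpow_cderiv (rob_coef alpha - 1) _ Hw))) as H.
  cbv beta in H. eapply eq_ind; [exact H|].
  apply one_minus_neq_0 in Hw. field.
  repeat split; [exact Hw | apply rob_coef_minus_1_neq_0 |].
  apply Cmod_gt_0. lra.
Qed.

Lemma extremal_C_derive2 (alpha : R) (c z : C) :
  Cmod c = 1 -> in_disk z ->
  C_derive (C_derive (extremal alpha c)) z
    = (C_derive (extremal alpha c) z * (rob_coef alpha * c / (1 - c * z)))%C.
Proof.
  intros Hc Hz. rewrite extremal_C_derive by assumption.
  apply cderiv_C_derive.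
  assert (Hw : Cmod (c * z) < 1)
    by (rewrite Cmod_mult, Hc; unfold in_disk in Hz; lra).
  assert (H1 : (1 - c * z)%C <> 0) by now apply one_minus_neq_0.
  apply (cderiv_ext
    (fun z => binpow (rob_coef alpha - 1) (c * z) * / (1 - c * z))%C
    _ z _ (1 - Cmod z)).
  - unfold in_disk in Hz. lra.
  - intros w Hwz. symmetry. apply extremal_C_derive; [exact Hc|]. unfold in_disk in *.
    replace w with ((w - z) + z)%C by ring.
    eapply Rle_lt_trans; [apply Cmod_triangle|]. lra.
  - pose proof (cderiv_mult _ _ _ _ _
      (cderiv_comp_scal _ z _ c (binpow_cderiv (rob_coef alpha - 1) _ Hw))
      (cderiv_inv_linear c z H1)) as H.
    cbv beta in H. eapply eq_ind; [exact H|].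
    field. exact H1.
Qed.

Lemma Cseries_constant_term (q w : C) :
  Cseries (fun n => match n with O => q | S _ => RtoC 0 end * w ^ n)%C q.
Proof.
  eapply eq_ind.
  - apply (Cseries_cons (fun n => match n with O => q | S _ => RtoC 0 end * w ^ n)%C 0).
    apply (Cseries_ext (fun _ => RtoC 0)); [|exact Cseries_zero]. intros n. ring.
  - simpl. ring.
Qed.

Lemma extremal_analytic (alpha : R) (c : C) :
  Cmod c = 1 -> analytic_in_disk (extremal alpha c).
Proof.
  intros Hc z0 Hz0. unfold in_disk in Hz0.
  set (B := (rob_coef alpha - 1)%C). set (p := (/ (c * B))%C).
  set (k := (/ (1 - c * z0) * c)%C).
  exists (fun n => p * binpow B (c * z0) * (binc B n * k ^ n)
             + match n with O => (- p)%C | S _ => RtoC 0 end)%C, (1 - Cmod z0).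
  split; [lra|]. intros z Hz. apply is_pseries_Cseries.
  assert (Hcz : Cmod (c * z0) = Cmod z0) by (rewrite Cmod_mult, Hc; ring).
  assert (Hcd : Cmod (c * (z - z0)) = Cmod (z - z0)) by (rewrite Cmod_mult, Hc; ring).
  assert (Hin : Cmod (k * (z - z0)) < 1).
  { unfold k. rewrite <- Cmult_assoc, Cmod_mult, Hcd.
    assert (H1 : (1 - c * z0)%C <> 0) by (apply one_minus_neq_0; lra).
    rewrite Cmod_inv by exact H1.
    pose proof (proj1 (Cmod_gt_0 _) H1) as Hpos.
    apply Rmult_lt_reg_l with (Cmod (1 - c * z0)); [exact Hpos|].
    rewrite <- Rmult_assoc, Rinv_r, Rmult_1_l, Rmult_1_r by lra.
    pose proof (Cmod_triangle (1 - c * z0) (c * z0)) as Ht.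
    replace (1 - c * z0 + c * z0)%C with (RtoC 1) in Ht by ring.
    rewrite Cmod_1 in Ht. lra. }
  replace (extremal alpha c z)
    with (p * binpow B (c * z0) * psum (binc B) (k * (z - z0)) + - p)%C.
  - eapply Cseries_ext; [|exact (Cseries_plus _ _ _ _
      (Cseries_scal (p * binpow B (c * z0)) _ _
         (psum_correct _ 1 _ (binc_summable B) Hin))
      (Cseries_constant_term (- p) (z - z0)))].
    intros n. cbv beta. rewrite Cpow_mult_l. ring.
  - unfold extremal. fold B. fold p. cbv zeta.
    replace (c * z)%C with (c * z0 + c * (z - z0))%C by ring.
    rewrite binpow_recenter by lra.
    unfold binpow at 3. unfold k. rewrite (Cmult_assoc (/ _)). ring.
Qed.

Lemma extremal_Robertson (alpha : R) (c : C) :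
  0 < cos alpha -> Cmod c = 1 -> Robertson alpha (extremal alpha c).
Proof.
  intros Hcos Hc. split; [now apply extremal_analytic|].
  assert (Hcz : forall z, in_disk z -> Cmod (c * z) < 1).
  { intros z Hz. rewrite Cmod_mult, Hc. unfold in_disk in Hz. lra. }
  assert (Hne : forall z, in_disk z -> C_derive (extremal alpha c) z <> 0).
  { intros z Hz. rewrite extremal_C_derive by assumption.
    specialize (Hcz z Hz). pose proof (one_minus_neq_0 _ Hcz) as H1.
    apply Cmult_neq_0.
    - exact (binpow_neq_0 _ _ Hcz).
    - intros E. apply (f_equal (Cmult (1 - c * z))) in E.
      rewrite Cinv_r, Cmult_0_r in E by exact H1. apply RtoC_inj in E. lra. }
  assert (H0 : in_disk 0) by (unfold in_disk; rewrite Cmod_0; lra).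
  split; [exact Hne|]. split; [|split].
  - unfold extremal. rewrite Cmult_0_r, binpow_0. ring.
  - rewrite extremal_C_derive by assumption.
    rewrite Cmult_0_r, binpow_0. field.
  - intros z Hz. rewrite extremal_C_derive2 by assumption.
    specialize (Hne z Hz). specialize (Hcz z Hz).
    set (d1 := C_derive (extremal alpha c) z) in *. set (w := (c * z)%C) in *.
    pose proof (one_minus_neq_0 _ Hcz) as H1.
    set (s := Cexpi alpha).
    assert (Hs : Re s = cos alpha) by reflexivity.
    set (p := (s * _)%C).
    (* p is the image of w under the inverse of p |-> (p - s) / (p + conj s) *)
    assert (Hp : (w * (p + Cconj s) = p - s)%C).
    { assert (E : (p = (s + Cconj s * w) / (1 - w))%C).
      { replace (Cconj s) with (s * rob_coef alpha - s)%C
          by (unfold s; rewrite Cexpi_mult_rob_coef; ring).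
        unfold p, w. field. split; [exact H1 | exact Hne]. }
      rewrite E. field. exact H1. }
    assert (Hps : (p + Cconj s)%C <> 0).
    { intros E. rewrite E, Cmult_0_r in Hp.
      assert (E' : (s + Cconj s)%C = 0).
      { replace (s + Cconj s)%C with ((p + Cconj s) - (p - s))%C by ring.
        rewrite E, <- Hp. ring. }
      apply (f_equal Re) in E'. rewrite re_plus, re_conj, Hs, re_RtoC in E'. lra. }
    pose proof (Cmod_half_plane_disk p s) as Hhp.
    rewrite <- Hp, Cmod_mult, Hs in Hhp.
    apply Cmod_gt_0 in Hps. pose proof (Cmod_ge_0 w) as Hw0.
    assert (Hlt : (Cmod w * Cmod (p + Cconj s)) ^ 2 < Cmod (p + Cconj s) ^ 2).
    { rewrite Rpow_mult_distr.
      assert (Cmod w ^ 2 < 1) by nra.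
      pose proof (pow_lt _ 2 Hps). nra. }
    assert (Hprod : 0 < Re p * cos alpha) by lra.
    apply Rmult_lt_reg_r with (cos alpha); [exact Hcos|]. lra.
Qed.

(** This c, for which 2/c points in the direction of sigma, turns the triangle
    inequality behind the bound into an equality. *)
Lemma aligned_unimodular (sigma : C) :
  Cmod sigma <= 2 ->
  exists c, Cmod c = 1 /\ Cmod (2 / c - sigma) = 2 - Cmod sigma.
Proof.
  intros H. destruct (Ceq_dec sigma 0) as [->|Hs].
  - exists 1. rewrite Cmod_1, Cmod_0. split; [reflexivity|].
    replace (2 / 1 - 0)%C with (RtoC 2) by (field; intros E; apply RtoC_inj in E; lra).
    rewrite Cmod_R, Rabs_pos_eq; lra.
  - pose proof (proj1 (Cmod_gt_0 _) Hs) as Hpos.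
    assert (Hm : RtoC (Cmod sigma) <> 0) by (intros E; apply RtoC_inj in E; lra).
    exists (Cmod sigma / sigma)%C. split.
    + rewrite Cmod_div by exact Hs. rewrite Cmod_R, Rabs_pos_eq by lra. field. lra.
    + replace (2 / (Cmod sigma / sigma) - sigma)%C
        with (sigma * RtoC ((2 - Cmod sigma) / Cmod sigma))%C.
      * rewrite Cmod_mult, Cmod_R, Rabs_pos_eq; [field; lra|].
        apply Rmult_le_pos; [lra | apply Rlt_le, Rinv_0_lt_compat, Hpos].
      * rewrite RtoC_div, RtoC_minus by lra. field. split; assumption.
Qed.

(** The identity A P = 2/phi - z (2 - A), with phi the constant c. *)
Lemma extremal_pole (alpha : R) (c z : C) :
  0 < cos alpha -> Cmod c = 1 -> in_disk z ->
  pole (extremal alpha c) z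
    = Some ((2 / c - z * (2 - rob_coef alpha)) / rob_coef alpha)%C.
Proof.
  intros Hcos Hc Hz. unfold pole.
  pose proof (proj1 (proj2 (extremal_Robertson alpha c Hcos Hc)) z Hz) as Hne.
  pose proof (rob_coef_neq_0 alpha Hcos) as HA.
  assert (Hc0 : c <> 0) by (apply Cmod_gt_0; lra).
  assert (H1 : (1 - c * z)%C <> 0).
  { apply one_minus_neq_0. rewrite Cmod_mult, Hc. unfold in_disk in Hz. lra. }
  rewrite extremal_C_derive2 by assumption.
  set (d1 := C_derive (extremal alpha c) z) in *.
  destruct (Ceq_dec _ _) as [E|_].
  - exfalso. apply Hne. set (A := rob_coef alpha) in *.
    replace d1 with ((d1 * (A * c / (1 - c * z))) * ((1 - c * z) / (A * c)))%C
      by (field; repeat split; assumption).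
    rewrite E. ring.
  - f_equal. field. repeat split; assumption.
Qed.

Theorem theorem4p8 :
  forall alpha : R, Rabs alpha < PI / 2 ->
    (forall f : C -> C, Robertson alpha f ->
       forall z : C, in_disk z ->
         Rbar_le (Finite (pole_bound alpha z)) (Cinf_mod (pole f z))) /\
    (forall z : C, in_disk z ->
       exists f : C -> C, Robertson alpha f /\
         Cinf_mod (pole f z) = Finite (pole_bound alpha z)).
Proof.
  intros alpha Halpha. apply cos_pos_of_Rabs in Halpha. split.
  - intros f Hf z Hz. now apply pole_bound_le.
  - intros z Hz. unfold in_disk in Hz.
    assert (H2 : Cmod (2 - rob_coef alpha) <= 2).
    { rewrite <- Cmod_1_minus_Cexpi.
      eapply Rle_trans; [apply Cmod_triangle|].
      rewrite Cmod_opp, Cmod_1, Cmod_Cexpi. lra. }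
    destruct (aligned_unimodular (z * (2 - rob_coef alpha))) as (c & Hc & Heq).
    { rewrite Cmod_mult. pose proof (Cmod_ge_0 z).
      pose proof (Cmod_ge_0 (2 - rob_coef alpha)). nra. }
    exists (extremal alpha c). split; [now apply extremal_Robertson|].
    rewrite extremal_pole by assumption. simpl. f_equal. unfold pole_bound.
    rewrite Cmod_1_plus_Cexpi, Cmod_1_minus_Cexpi.
    rewrite Cmod_div by now apply rob_coef_neq_0.
    rewrite Heq, Cmod_mult. f_equal. ring.
Qed.
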